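(* Consider the interacting urn process on a finite weakly connected directed graph $\mathcal G=(V,\mathcal E)$, $V=[N]=S\cup F$, with parameters $(q_i,m_i,\alpha_i,\beta_i)_{i\in V}$, as defined in the context. Suppose $F$ (the subgraph induced on the flexible nodes) is strongly connected and one of the following conditions holds: (i) there exists a node $i$ with $q_i\in(0,1)$; (ii) there exists a non-Pólya type node in $F$; (iii) $S\neq\emptyset$; (iv) $q_i\in\{0,1\}$ for all $i$, all nodes in $F$ are of Pólya type, and $F$ does not admit a valid graph partition under the exploration process. Put $r_j=\alpha_j+\beta_j-m_j$ and $\overline m_i=\sum_{j\in N_i}m_j$, and suppose further that there exist constants $\mu_F$ and $\mu_0$ such that for all $i\in F$ $$\text{(SC1)}\quad \frac1{\overline m_i}\sum_{j\in F\cap N_i}(2q_j-1)r_j=\mu_F,$$ $$\text{(SC2)}\quad \frac1{\overline m_i}\Big(\sum_{j\in S\cap N_i}Z_j^0(2q_j-1)r_j+\sum_{j\in N_i}(\alpha_j-q_jr_j)\Big)=\mu_0.$$ Then, for every $i\in F$, almost surely as $t\to\infty$, $$Z_i^t\to z^\star=\frac{\mu_0}{1-\mu_F}.$$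
   Context: Graph. $\mathcal G=(V,\mathcal E)$ is a finite directed graph, $V=[N]=\{1,\dots,N\}$, weakly connected; $i\to j$ means there is a directed edge from $i$ to $j$. In-neighbourhood: $N_i=\{j\in V:j\to i\}$. Stubborn nodes: $S=\{i:N_i=\emptyset\}$; flexible nodes: $F=V\setminus S$. Urn process. Each node $i$ has an urn with $W_i^t$ white and $B_i^t$ black balls at time $t$; $T_i^t=W_i^t+B_i^t$, $T_i^0>0$, $Z_i^t=W_i^t/T_i^t$, $\mathbf Z^t=(Z_1^t,\dots,Z_N^t)$, $\mathcal F_t=\sigma(\mathbf Z^0,\dots,\mathbf Z^t)$; the initial configuration is fixed. Each node has parameters $q_i\in[0,1]$ and integers $m_i\ge1$, $\alpha_i,\beta_i\in\{0,\dots,m_i\}$. Given $\mathcal F_t$, the variables $\chi_i^{t+1}$, $i\in V$ (indicator that a white ball is drawn from urn $i$) are independent Bernoulli with $P(\chi_i^{t+1}=1\mid\mathcal F_t)=q_iZ_i^t+(1-q_i)(1-Z_i^t)$. Then for all $i\in V$, $W_i^{t+1}=W_i^t+\sum_{j\in N_i}[\alpha_j\chi_j^{t+1}+(m_j-\beta_j)(1-\chi_j^{t+1})]$ and $B_i^{t+1}=B_i^t+\sum_{j\in N_i}[(m_j-\alpha_j)\chi_j^{t+1}+\beta_j(1-\chi_j^{t+1})]$. Node $i$ is of Pólya type if $\alpha_i=\beta_i=m_i$ and of non-Pólya type if $0<\alpha_i+\beta_i<2m_i$; every node is assumed to be of one of these two types. Node $i$ is preferential if $q_i=1$ and de-preferential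 if $q_i=0$. Exploration process / valid graph partition. Let $H$ be a directed graph with node set $U$, each node being preferential or de-preferential; let $\mathcal P,\mathcal D$ be the sets of preferential and de-preferential nodes of $H$ and let $N_j$ denote in-neighbourhoods in $H$. Select a node $j\in U$; if $j\in\mathcal P$ initialise $P_1=\{j\}$, $P_2=D_1=D_2=\emptyset$; otherwise initialise $D_1=\{j\}$, $P_1=P_2=D_2=\emptyset$. While $P_1\cup P_2\cup D_1\cup D_2\subsetneq U$, perform in order the updates: (1) add $\bigcup_{j\in P_1}N_j\cap\mathcal P$ to $P_1$ and $\bigcup_{j\in P_1}N_j\cap\mathcal D$ to $D_1$; (2) add $\bigcup_{j\in D_1}N_j\cap\mathcal P$ to $P_2$ and $\bigcup_{j\in D_1}N_j\cap\mathcal D$ to $D_2$; (3) add $\bigcup_{j\in D_2}N_j\cap\mathcal P$ to $P_1$ and $\bigcup_{j\in D_2}N_j\cap\mathcal D$ to $D_1$; (4) add $\bigcup_{j\in P_2}N_j\cap\mathcal P$ to $P_2$ and $\bigcup_{j\in P_2}N_j\cap\mathcal D$ to $D_2$; if the four sets are not mutually disjoint, stop: $H$ does not admit a graph partition. Once the four sets cover $U$, perform updates (1)–(4) once more; if some node is re-assigned from $P_1$ to $P_2$ (or vice versa) or from $D_1$ to $D_2$ (or vice versa), $H$ does not admit a graph partition; otherwise $H$ admits the (valid) graph partition $(P_1,P_2,D_1,D_2)$. The outcome does not depend on the initial node. For $F$, apply this to the subgraph induced on $F$. *)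

(* Defs.v *)
From HB Require Import structures.
From mathcomp Require Import all_boot all_order all_algebra.
From mathcomp Require Import all_classical all_reals all_analysis.

Set Implicit Arguments.
Unset Strict Implicit.
Unset Printing Implicit Defensive.

Import Order.TTheory GRing.Theory Num.Theory.
Import numFieldNormedType.Exports.

Local Open Scope classical_set_scope.
Local Open Scope ring_scope.

Record urn_network (R : realType) (N : nat) := UrnNetwork {
  edge : rel 'I_N;
  q_ : 'I_N -> R;
  m_ : 'I_N -> nat;
  alpha_ : 'I_N -> nat;
  beta_ : 'I_N -> nat;
  W0 : 'I_N -> nat;
  B0 : 'I_N -> nat;
  q_itv : forall i, 0 <= q_ i <= 1;
  m_ge1 : forall i, (1 <= m_ i)%N;
  alpha_le : forall i, (alpha_ i <= m_ i)%N;
  beta_le : forall i, (beta_ i <= m_ i)%N;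
  T0_gt0 : forall i, (0 < W0 i + B0 i)%N }.

Section Network.
Variables (R : realType) (N : nat) (G : urn_network R N).

Definition in_nbr (i : 'I_N) : {set 'I_N} := [set j | edge G j i].

Definition stubborn : {set 'I_N} := [set i | in_nbr i == finset.set0].

Definition flexible : {set 'I_N} := finset.setC stubborn.

Definition weakly_connected : Prop :=
  forall i j, connect [rel x y | edge G x y || edge G y x] i j.

(* The subgraph induced on [U] is strongly connected. *)
Definition strongly_connected_on (U : {set 'I_N}) : Prop :=
  {in U &, forall i j,
    connect [rel x y | [&& x \in U, y \in U & edge G x y]] i j}.

Definition polya_type (i : 'I_N) : Prop :=
  alpha_ G i = m_ G i /\ beta_ G i = m_ G i.

Definition non_polya_type (i : 'I_N) : Prop :=
  (0 < alpha_ G i + beta_ G i < 2 * m_ G i)%N.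

Definition r_ (j : 'I_N) : R :=
  (alpha_ G j)%:R + (beta_ G j)%:R - (m_ G j)%:R.

Definition mbar (i : 'I_N) : nat := (\sum_(j in in_nbr i) m_ G j)%N.

(* [x t j] is the indicator of drawing white from urn [j] at time [t >= 1];
   [x 0] is not used.  The truncated differences are genuine ones, by
   [alpha_le] and [beta_le]. *)
Fixpoint white (x : nat -> 'I_N -> bool) (t : nat) (i : 'I_N) : nat :=
  if t is s.+1 then
    (white x s i + \sum_(j in in_nbr i)
      (alpha_ G j * x t j + (m_ G j - beta_ G j) * (1 - x t j)))%N
  else W0 G i.

Fixpoint black (x : nat -> 'I_N -> bool) (t : nat) (i : 'I_N) : nat :=
  if t is s.+1 then
    (black x s i + \sum_(j in in_nbr i)
      ((m_ G j - alpha_ G j) * x t j + beta_ G j * (1 - x t j)))%N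
  else B0 G i.

Definition fraction (x : nat -> 'I_N -> bool) (t : nat) (i : 'I_N) : R :=
  (white x t i)%:R / (white x t i + black x t i)%:R.

Definition Z0 (i : 'I_N) : R := (W0 G i)%:R / (W0 G i + B0 G i)%:R.

Record exploration := Exploration {
  eP1 : {set 'I_N}; eP2 : {set 'I_N}; eD1 : {set 'I_N}; eD2 : {set 'I_N} }.

Section Explore.
Variable U : {set 'I_N}.

Definition pref : {set 'I_N} := [set i in U | q_ G i == 1].
Definition depref : {set 'I_N} := [set i in U | q_ G i == 0].

(* In-neighbours of nodes of [A] in the subgraph induced on [U]. *)
Definition in_nbrs_on (A : {set 'I_N}) : {set 'I_N} :=
  (\bigcup_(j in A) [set k in U | edge G k j])%SET.

Definition addP (A X : {set 'I_N}) : {set 'I_N} :=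
  (X :|: in_nbrs_on A :&: pref)%SET.
Definition addD (A X : {set 'I_N}) : {set 'I_N} :=
  (X :|: in_nbrs_on A :&: depref)%SET.

(* Within one update all additions use the set [A] as it was before it; the
   four updates of a round are performed one after the other. *)
Definition update1 (s : exploration) : exploration :=
  let A := eP1 s in
  Exploration (addP A (eP1 s)) (eP2 s) (addD A (eD1 s)) (eD2 s).
Definition update2 (s : exploration) : exploration :=
  let A := eD1 s in
  Exploration (eP1 s) (addP A (eP2 s)) (eD1 s) (addD A (eD2 s)).
Definition update3 (s : exploration) : exploration :=
  let A := eD2 s in
  Exploration (addP A (eP1 s)) (eP2 s) (addD A (eD1 s)) (eD2 s).
Definition update4 (s : exploration) : exploration :=
  let A := eP2 s in
  Exploration (eP1 s) (addP A (eP2 s)) (eD1 s) (addD A (eD2 s)).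

Definition round (s : exploration) : exploration :=
  update4 (update3 (update2 (update1 s))).

Definition explore_init (j : 'I_N) : exploration :=
  if j \in pref
  then Exploration [set j]%SET finset.set0 finset.set0 finset.set0
  else Exploration finset.set0 finset.set0 [set j]%SET finset.set0.

Definition covers (s : exploration) : Prop :=
  (eP1 s :|: eP2 s :|: eD1 s :|: eD2 s)%SET = U.

Definition mutually_disjoint (s : exploration) : Prop :=
  [&& [disjoint eP1 s & eP2 s], [disjoint eP1 s & eD1 s],
      [disjoint eP1 s & eD2 s], [disjoint eP2 s & eD1 s],
      [disjoint eP2 s & eD2 s] & [disjoint eD1 s & eD2 s]].

(* Some node of [s] is moved to the opposite class in [s']. *)
Definition reassigned (s s' : exploration) : Prop :=
  exists i : 'I_N,
    [|| (i \in eP1 s) && (i \in eP2 s'), (i \in eP2 s) && (i \in eP1 s'),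
        (i \in eD1 s) && (i \in eD2 s') | (i \in eD2 s) && (i \in eD1 s')].

(* The while loop started from state [s] succeeds.  Being inductive, this
   fails for a run that never covers [U]; such runs do not exist when the
   subgraph induced on [U] is strongly connected. *)
Inductive explore_succeeds : exploration -> Prop :=
| Explore_final s :
    covers s -> ~ reassigned s (round s) -> explore_succeeds s
| Explore_loop s :
    ~ covers s -> mutually_disjoint (round s) ->
    explore_succeeds (round s) -> explore_succeeds s.

(* For strongly connected induced subgraphs, the outcome does not depend on
   the selected node [j]. *)
Definition admits_graph_partition : Prop :=
  forall j, j \in U -> explore_succeeds (explore_init j).

End Explore.

End Network.

Section Process.
Variables (R : realType) (d : measure_display) (Omega : measurableType d).
Variable P : probability Omega R.

(* [f] is a version of the conditional probability P(E | H), for [H] a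
   sub-sigma-algebra given as a set of events. *)
Definition is_cond_prob (H : set (set Omega)) (E : set Omega)
    (f : Omega -> R) : Prop :=
  (forall B : set R, measurable B -> H (f @^-1` B)) /\
  (forall A : set Omega, H A ->
     P (A `&` E) = (\int[P]_(w in A) (f w)%:E)%E).

Variables (N : nat) (G : urn_network R N).
Variable chi : nat -> 'I_N -> {RV P >-> bool}.

Definition Z (t : nat) (i : 'I_N) (w : Omega) : R :=
  fraction G (fun s j => chi s j w) t i.

Definition history (t : nat) : set (set Omega) :=
  <<s [set A | exists s i (B : set R),
         [/\ (s <= t)%N, measurable B & A = Z s i @^-1` B]] >>.

Definition draw_prob (t : nat) (i : 'I_N) (w : Omega) : R :=
  q_ G i * Z t i w + (1 - q_ G i) * (1 - Z t i w).

(* Given the history up to [t], the draws at time [t + 1] are independent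
   Bernoulli variables: product rule on every subfamily [J] (the singletons
   give the success probabilities). *)
Definition urn_process : Prop :=
  forall (t : nat) (J : {set 'I_N}),
    is_cond_prob (history t)
      [set w | forall i, i \in J -> chi t.+1 i w = true]
      (fun w => \prod_(i in J) draw_prob t i w).

End Process.

(* Main.v *)
Require Import Defs.
From mathcomp Require Import all_boot all_order all_algebra.
From mathcomp Require Import all_classical all_reals all_analysis.
From mathcomp Require Import measurable_realfun.
From mathcomp Require Import ring lra zify.
Import Order.TTheory GRing.Theory Num.Theory.
Import numFieldNormedType.Exports.
Local Open Scope classical_set_scope.
Local Open Scope ring_scope.
Set Implicit Arguments.
Unset Strict Implicit.

(* Write [x_i = Z_i - z*].  On [F] the mean drift of [x] is [(A - I) x] with
   [A_ij = K_ij s_j], [K_ij = m_j / mbar_i] and [s_j = (2 q_j - 1) r_j / m_j].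
   The substochastic irreducible matrix [K] has positive weights [p] with
   [p K <= p], so by AM-GM the dissipation [D = sum_i p_i x_i (x_i - (A x)_i)]
   is a sum of nonnegative terms; conditions (i)-(iv) are what makes [D x -> 0]
   force [x -> 0].  In case (iv) a nonzero zero of [D] would be a choice of
   signs constant along preferential edges and alternating along
   de-preferential ones, that is, a valid graph partition.

   The noise is orthogonal to the past, so the expectation of
   [V = sum_i p_i x_i^2] decreases by [2 E(D) / (t + 1)] up to [O(1 / t^2)].
   Hence [sum_t D_t / (t + 1)] is almost surely finite, and since [D_t] moves by
   [O(1 / t)] per step, it tends to [0].  This replaces both the martingale
   convergence theorem and the ODE method. *)

(** * Subinvariant weights of an irreducible substochastic matrix *)

Lemma connect_closed_ind (T : finType) (e : rel T) (Q : T -> Prop) :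
  (forall x y, e x y -> Q x -> Q y) ->
  forall x y, connect e x y -> Q x -> Q y.
Proof.
move=> HQ x y /connectP[p]; elim: p x => [|z p IH] x /= => [_ -> //|].
by move=> /andP[exz pz] lastp Qx; apply: (IH z) => //; apply: HQ Qx.
Qed.

Lemma stochastic_left_eigenvector (R : realFieldType) (n : nat)
    (K : 'I_n.+1 -> 'I_n.+1 -> R) :
  (forall i j, 0 <= K i j) -> (forall i, \sum_j K i j = 1) ->
  exists v : 'I_n.+1 -> R, [/\ forall i, 0 <= v i, exists i, v i != 0
    & forall j, \sum_i v i * K i j = v j].
Proof.
move=> K0 K1; pose M := \matrix_(i, j) K i j - 1%:M : 'M[R]_n.+1.
have dM : \det M == 0.
  rewrite -det_tr; apply/det0P; exists (const_mx 1).
    by apply/eqP => /matrixP /(_ 0 0); rewrite !mxE; apply/eqP/oner_neq0.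
  apply/matrixP => a i; rewrite !mxE.
  under eq_bigr do rewrite !mxE mul1r.
  rewrite sumrB K1 (bigD1 i)//=. by rewrite eqxx big1 ?addr0 ?subrr// => j /negPf ji;
    rewrite eq_sym ji.
have /det0P[v v0 vM] := dM.
have vK j : \sum_i v 0 i * K i j = v 0 j.
  have := vM => /matrixP/(_ 0 j); rewrite !mxE.
  under eq_bigr do rewrite !mxE mulrBr.
  rewrite sumrB [X in _ - X](bigD1 j)//= eqxx mulr1.
  rewrite [X in _ - (_ + X)]big1 ?addr0; last first.
    by move=> i /negPf ij; rewrite ij mulr0.
  by move/eqP; rewrite subr_eq0 => /eqP.
(* [|v| <= |v| K] entrywise, and both sides have the same total mass *)
have le j : `|v 0 j| <= \sum_i `|v 0 i| * K i j.
  rewrite -vK (le_trans (ler_norm_sum _ _ _))//; apply: ler_sum => i _.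
  by rewrite normrM (ger0_norm (K0 _ _)).
have tot : \sum_j (\sum_i `|v 0 i| * K i j - `|v 0 j|) = 0.
  rewrite sumrB exchange_big/=.
  under eq_bigr do rewrite -mulr_sumr K1 mulr1.
  by rewrite subrr.
exists (fun i => `|v 0 i|); split=> //.
- have /rV0Pn[i vi] := v0; exists i; by rewrite normr_eq0.
- move=> j; apply/eqP; rewrite -subr_eq0; apply/eqP.
  have /psumr_eq0P : forall i, true -> 0 <= \sum_i0 `|v 0 i0| * K i0 i - `|v 0 i|.
    by move=> i _; rewrite subr_ge0.
  by apply.
Qed.

Lemma subinvariant_weights (R : realFieldType) (N : nat) (F : {set 'I_N})
    (K : 'I_N -> 'I_N -> R) :
  (forall i j, 0 <= K i j) ->
  {in F, forall i, \sum_(j in F) K i j <= 1} ->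
  {in F &, forall j i,
     connect [rel x y | [&& x \in F, y \in F & 0 < K y x]] j i} ->
  exists p : 'I_N -> R, {in F, forall i, 0 < p i} /\
    {in F, forall j, \sum_(i in F) p i * K i j <= p j}.
Proof.
have [->|[i0 i0F]] := set_0Vmem F.
  by move=> *; exists (fun=> 1); split=> i; rewrite inE.
case: N => [|n] in F K i0 i0F *; first by case: i0 i0F.
move=> K0 K1 Kc.
(* the missing mass of a row of [F] is put on the diagonal, and the rows
   outside [F] jump to [i0] *)
pose K' i j := if i \in F then
    if j \in F then K i j + (1 - \sum_(k in F) K i k) *+ (j == i) else 0
  else (j == i0)%:R.
have K'0 i j : 0 <= K' i j.
  rewrite /K'; case: ifPn => [iF|_]; last exact: ler0n.
  by case: ifPn => // _; rewrite addr_ge0// mulrn_wge0// subr_ge0 K1.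
have K'1 i : \sum_j K' i j = 1.
  rewrite /K'; case: (boolP (i \in F)) => [iF|_].
    rewrite -big_mkcond/= big_split/=; set c := 1 - _.
    suff -> : \sum_(j in F) c *+ (j == i) = c by rewrite addrC subrK.
    rewrite (bigD1 i)//= eqxx mulr1n big1 ?addr0// => j /andP[_ /negPf ->].
    by rewrite mulr0n.
  by rewrite (bigD1 i0)//= eqxx big1 ?addr0// => j /negPf ->.
have [v [v0 [k vk] vK]] := stochastic_left_eigenvector K'0 K'1.
have vF j : j \notin F -> v j = 0.
  move=> jF; rewrite -vK big1// => i _; rewrite /K' (negPf jF).
  case: (i \in F); first by rewrite mulr0.
  have [ji|_] := eqVneq j i0; last by rewrite mulr0.
  by rewrite ji i0F in jF.
have kF : k \in F by apply: contraNT vk => /vF ->.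
have subv j : j \in F -> \sum_(i in F) v i * K i j <= v j.
  move=> jF; rewrite -(vK j) [X in _ <= X](bigID (mem F))/= ler_wpDr//.
    by apply: sumr_ge0 => i _; rewrite mulr_ge0.
  apply: ler_sum => i iF; rewrite ler_wpM2l// /K' iF jF lerDl.
  by rewrite mulrn_wge0// subr_ge0 K1.
exists v; split=> // i iF.
have step x y : [&& x \in F, y \in F & 0 < K y x] -> v x = 0 -> v y = 0.
  move=> /and3P[xF yF Kyx] vx; have := subv x xF; rewrite vx => le0.
  have := v0 y; rewrite le_eqVlt => /predU1P[//|vy].
  suff : 0 < \sum_(i in F) v i * K i x by rewrite ltNge le0.
  rewrite (bigD1 y)//= ltr_wpDr ?mulr_gt0//.
  by apply: sumr_ge0 => z _; rewrite mulr_ge0.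
have := v0 i; rewrite le_eqVlt => /predU1P[vi|//].
by move: vk; rewrite (connect_closed_ind step (Kc i k iF kF)) ?eqxx.
Qed.

(** * Dissipation *)

Definition dissipation (R : realType) (T : finType) (F : {set T})
    (K : T -> T -> R) (sg p x : T -> R) : R :=
  \sum_(i in F) p i * (x i * (x i - \sum_(j in F) K i j * sg j * x j)).

(* The two sides differ by [sum_j (p_j - (p K)_j) x_j ^ 2]. *)
Lemma dissipation_ge (R : realType) (T : finType) (F : {set T})
    (K : T -> T -> R) (sg p x : T -> R) :
  {in F, forall j, \sum_(i in F) p i * K i j <= p j} ->
  \sum_(i in F) p i * (1 - \sum_(j in F) K i j) * x i ^+ 2 +
  \sum_(i in F) \sum_(j in F)
     p i * K i j * (x i ^+ 2 + x j ^+ 2 - 2 * sg j * x i * x j)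
  <= 2 * dissipation F K sg p x.
Proof.
move=> pK; rewrite -subr_ge0 /dissipation.
have -> : 2 * (\sum_(i in F) p i * (x i * (x i - \sum_(j in F) K i j * sg j * x j)))
  - (\sum_(i in F) p i * (1 - \sum_(j in F) K i j) * x i ^+ 2 +
  \sum_(i in F) \sum_(j in F)
     p i * K i j * (x i ^+ 2 + x j ^+ 2 - 2 * sg j * x i * x j))
  = \sum_(j in F) (p j - \sum_(i in F) p i * K i j) * x j ^+ 2.
  rewrite mulr_sumr -big_split -sumrB/=.
  under [RHS]eq_bigr do rewrite mulrBl mulr_suml.
  rewrite [RHS]sumrB [X in _ = _ - X]exchange_big -[RHS]sumrB/=.
  apply: eq_bigr => i _.
  transitivity (p i * x i ^+ 2 -
     (\sum_(j in F) 2 * p i * x i * (K i j * sg j * x j)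
      - \sum_(j in F) p i * x i ^+ 2 * K i j
      + \sum_(j in F)
     p i * K i j * (x i ^+ 2 + x j ^+ 2 - 2 * sg j * x i * x j))).
    by rewrite -!mulr_sumr; ring.
  congr (_ - _); rewrite -sumrB -big_split/=.
  by apply: eq_bigr => j _; ring.
by apply: sumr_ge0 => j jF; rewrite mulr_ge0 ?sqr_ge0// subr_ge0 pK.
Qed.

Lemma dominated_cvg0 (R : realType) (u v : nat -> R) (c : R) : 0 < c ->
  (forall t, 0 <= u t) -> (forall t, c * u t <= v t) ->
  v @ \oo --> 0 -> u @ \oo --> 0.
Proof.
move=> c0 u0 uv v0; apply: (@squeeze_cvgr _ _ _ _ (fun=> 0) (fun t => c^-1 * v t)).
- by apply: nearW => t; rewrite u0/= mulrC ler_pdivlMr// mulrC.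
- exact: cvg_cst.
- by rewrite -(mulr0 c^-1); exact: cvgMl_tmp.
Qed.

Lemma sqr_cvg0 (R : realType) (u : nat -> R) :
  (fun t => u t ^+ 2) @ \oo --> 0 -> u @ \oo --> 0.
Proof.
move=> u0; apply: norm_cvg0.
under eq_fun do rewrite -sqrtr_sqr.
rewrite -(@sqrtr0 R); apply: (continuous_cvg _ _ u0); exact: sqrt_continuous.
Qed.

Lemma sum_cvg0 (R : realType) (I : finType) (P : pred I) (u : I -> nat -> R) :
  (forall i, P i -> u i @ \oo --> 0) ->
  (fun t => \sum_(i | P i) u i t) @ \oo --> 0.
Proof.
move=> u0; rewrite [X in _ --> X](_ : 0 = \sum_(i | P i) (0 : R)); last by rewrite big1.
exact: (@cvg_big _ _ +%R 0 P (@add_continuous R) _ \oo _ u (fun=> 0)).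
Qed.

Section Vanishing.
Variables (R : realType) (T : finType) (F : {set T}).
Variables (K : T -> T -> R) (sg p : T -> R).
Hypotheses (K0 : forall i j, 0 <= K i j)
  (K1 : {in F, forall i, \sum_(j in F) K i j <= 1})
  (sg1 : forall j, `|sg j| <= 1)
  (p0 : {in F, forall i, 0 < p i})
  (pK : {in F, forall j, \sum_(i in F) p i * K i j <= p j}).

Let D (x : T -> R) i j := x i ^+ 2 + x j ^+ 2 - 2 * sg j * x i * x j.

Lemma sqr_defect_ge x i j :
  (`|x i| - `|x j|) ^+ 2 + 2 * (1 - `|sg j|) * `|x i| * `|x j| <= D x i j.
Proof.
have : sg j * x i * x j <= `|sg j| * `|x i| * `|x j|.
  by rewrite -!normrM ler_norm.
by rewrite /D -(real_normK (num_real (x i))) -(real_normK (num_real (x j))); lra.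
Qed.

Lemma defect_ge0 x i j : 0 <= D x i j.
Proof.
apply: le_trans (sqr_defect_ge x i j).
by rewrite addr_ge0 ?sqr_ge0// !mulr_ge0// subr_ge0.
Qed.

Lemma deficit_ge0 (x : T -> R) i : i \in F ->
  0 <= p i * (1 - \sum_(j in F) K i j) * x i ^+ 2.
Proof.
by move=> iF; rewrite mulr_ge0 ?sqr_ge0// mulr_ge0 ?subr_ge0 ?K1// ltW ?p0.
Qed.

Lemma dissipation_ge_row x i : i \in F ->
  p i * (1 - \sum_(j in F) K i j) * x i ^+ 2 <= 2 * dissipation F K sg p x.
Proof.
move=> iF; apply: le_trans (dissipation_ge sg x pK).
rewrite ler_wpDr//.
  by do 2![apply: sumr_ge0 => ? ?]; rewrite !mulr_ge0 ?defect_ge0// ltW// p0.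
rewrite [leRHS](bigD1 i)//= ler_wpDr//.
by apply: sumr_ge0 => j /andP[jF _]; exact: deficit_ge0.
Qed.

Lemma dissipation_ge_edge x i j : i \in F -> j \in F ->
  p i * K i j * D x i j <= 2 * dissipation F K sg p x.
Proof.
move=> iF jF; apply: le_trans (dissipation_ge sg x pK).
rewrite ler_wpDl//.
  by apply: sumr_ge0 => k; exact: deficit_ge0.
have nng a b : a \in F -> 0 <= p a * K a b * D x a b.
  by move=> aF; rewrite !mulr_ge0 ?defect_ge0// ltW// p0.
rewrite (bigD1 i)//= (bigD1 j)//= -addrA ler_wpDr// addr_ge0//.
  by apply: sumr_ge0 => b _; rewrite nng.
by apply: sumr_ge0 => a /andP[aF _]; apply: sumr_ge0 => b _; rewrite nng.
Qed.

Lemma dissipation_ge0 x : 0 <= dissipation F K sg p x.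
Proof.
suff : 0 <= 2 * dissipation F K sg p x by rewrite pmulr_rge0.
apply: le_trans (dissipation_ge sg x pK); rewrite addr_ge0//.
  by apply: sumr_ge0 => k; exact: deficit_ge0.
by do 2![apply: sumr_ge0 => ? ?]; rewrite !mulr_ge0 ?defect_ge0// ltW// p0.
Qed.

Hypothesis conn : {in F &, forall j i,
  connect [rel x y | [&& x \in F, y \in F & 0 < K y x]] j i}.

Lemma dissipation_vanish (x : nat -> T -> R) :
  (exists2 i, i \in F & \sum_(j in F) K i j < 1) \/
  (exists i j, [/\ i \in F, j \in F, 0 < K i j & `|sg j| < 1]) \/
  (forall s : T -> bool, exists i j,
    [/\ i \in F, j \in F, 0 < K i j & s i != s j (+) (sg j < 0)]) ->
  (fun t => dissipation F K sg p (x t)) @ \oo --> 0 ->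
  {in F, forall i, x ^~ i @ \oo --> 0}.
Proof.
move=> nondeg diss0.
have diss20 : (fun t => 2 * dissipation F K sg p (x t)) @ \oo --> 0.
  by rewrite -(mulr0 2); exact: cvgMl_tmp.
have D0 i j : i \in F -> j \in F -> 0 < K i j ->
    (fun t => D (x t) i j) @ \oo --> 0.
  move=> iF jF Kij; apply: dominated_cvg0 diss20; last 2 first.
  - by move=> t; exact: defect_ge0.
  - by move=> t; apply: dissipation_ge_edge.
  - by rewrite mulr_gt0 ?p0.
have abs0 : {in F &, forall j i, (fun t => `|x t i| - `|x t j|) @ \oo --> 0}.
  move=> j i jF iF; move: (conn jF iF).
  pose Q i := (fun t => `|x t i| - `|x t j|) @ \oo --> (0 : R).
  have Qj : Q j.
    rewrite /Q; under eq_fun do rewrite subrr; exact: cvg_cst.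
  move=> jci; apply: (connect_closed_ind _ jci Qj) => a b /and3P[aF bF Kba] Qa.
  rewrite /Q; have -> : (fun t => `|x t b| - `|x t j|) =
    (fun t => `|x t b| - `|x t a|) \+ (fun t => `|x t a| - `|x t j|).
    by apply/funext => t /=; rewrite addrA subrK.
  rewrite -[X in _ --> X]addr0; apply: cvgD => //.
  apply: sqr_cvg0; apply: dominated_cvg0 ltr01 _ _ (D0 _ _ bF aF Kba).
    by move=> t; exact: sqr_ge0.
  move=> t; rewrite mul1r; apply: le_trans (sqr_defect_ge (x t) b a).
  by rewrite lerDl !mulr_ge0// subr_ge0.
(* all moduli on [F] agree in the limit, so a moving witness suffices *)
have moving (y : nat -> R) : y @ \oo --> 0 ->
    (forall t, exists2 i, i \in F & x t i ^+ 2 <= y t) ->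
    {in F, forall i, x ^~ i @ \oo --> 0}.
  move=> y0 xy i iF; apply: norm_cvg0.
  apply: (@squeeze_cvgr _ _ _ _ (fun=> 0)
    (fun t => Num.sqrt (y t) + \sum_(j in F) `| `|x t i| - `|x t j| |)).
  - apply: nearW => t; rewrite normr_ge0/=.
    have [j jF xjy] := xy t.
    have xj : `|x t j| <= Num.sqrt (y t).
      by rewrite -sqrtr_sqr ler_sqrt// (le_trans _ xjy)// sqr_ge0.
    rewrite (bigD1 j)//= addrA ler_wpDr ?sumr_ge0//.
    by have := ler_norm (`|x t i| - `|x t j|); lra.
  - exact: cvg_cst.
  - rewrite -[X in _ --> X]addr0; apply: cvgD.
      rewrite -(@sqrtr0 R); apply: (continuous_cvg _ _ y0); exact: sqrt_continuous.
    apply: sum_cvg0 => j jF; apply/norm_cvg0P; exact: abs0.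
case: nondeg => [[i iF Ki]|[[i [j [iF jF Kij sgj]]]|signs]].
- apply: (moving (fun t => x t i ^+ 2)); last by move=> t; exists i.
  apply: dominated_cvg0 diss20; last 2 first.
  + by move=> t; exact: sqr_ge0.
  + by move=> t; exact: dissipation_ge_row.
  + by rewrite mulr_gt0 ?p0// subr_gt0.
- apply: (moving (fun t => x t i ^+ 2)); last by move=> t; exists i.
  apply: dominated_cvg0 (D0 _ _ iF jF Kij); last 2 first.
  + by move=> t; exact: sqr_ge0.
  + move=> t; apply: le_trans (sqr_defect_ge (x t) i j).
    rewrite -(real_normK (num_real (x t i))).
    instantiate (1 := 1 - `|sg j|).
    have := mulr_ge0 (normr_ge0 (sg j)) (sqr_ge0 (`|x t i| - `|x t j|)).
    have : 0 <= (1 - `|sg j|) * `|x t j| ^+ 2 by rewrite mulr_ge0// subr_ge0.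
    by lra.
  + by rewrite subr_gt0.
- pose edges (e : T * T) := [&& e.1 \in F, e.2 \in F & 0 < K e.1 e.2].
  apply: (moving (fun t => \sum_(e | edges e) D (x t) e.1 e.2)).
    by apply: sum_cvg0 => -[i j] /and3P[/= iF jF Kij]; exact: D0.
  move=> t; have [i [j [iF jF Kij sij]]] := signs (fun k => x t k < 0).
  exists i => //; rewrite (bigD1 (i, j)) /edges/= ?iF ?jF//.
  rewrite ler_wpDr//; first by apply: sumr_ge0 => e _; exact: defect_ge0.
  suff : sg j * x t i * x t j <= 0.
    by rewrite /D; have := sqr_ge0 (x t j); lra.
  move: sij; case: (ltP (x t i) 0); case: (ltP (x t j) 0); case: (ltP (sg j) 0) => //=
    sj xj xi _; rewrite -mulrA.
  - by rewrite nmulr_rle0// ltW// nmulr_rgt0.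
  - by rewrite mulr_ge0_le0// mulr_le0_ge0// ltW.
  - by rewrite mulr_ge0_le0// mulr_ge0_le0// ltW.
  - by rewrite mulr_le0_ge0 ?(ltW sj)// mulr_ge0.
Qed.

End Vanishing.

(** * The exploration process *)

Section Exploration.
Variables (R : realType) (N : nat) (G : urn_network R N) (U : {set 'I_N}).
Hypothesis q01 : {in U, forall i, q_ G i = 0 \/ q_ G i = 1}.
(* [s] marks the nodes of [P2] and [D1] *)
Variable s : 'I_N -> bool.
Hypothesis s_edge : {in U &, forall j i, edge G j i ->
  s i = s j (+) (q_ G j == 0)}.

Let cls (q : R) (b : bool) : {set 'I_N} :=
  [set i in U | (q_ G i == q) && (s i == b)].

Let sorted_by_sign (e : @exploration N) : bool :=
  [&& eP1 e \subset cls 1 false, eP2 e \subset cls 1 true,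
      eD1 e \subset cls 0 true & eD2 e \subset cls 0 false].

Let cover (e : @exploration N) : {set 'I_N} :=
  (eP1 e :|: eP2 e :|: eD1 e :|: eD2 e)%SET.

Let cls_sub q b (A : {set 'I_N}) : A \subset cls q b ->
  {in A, forall i, i \in U /\ s i = b}.
Proof.
by move=> /fintype.subsetP sA i /sA; rewrite inE => /and3P[-> _ /eqP].
Qed.

Let addP_sub q b (A X : {set 'I_N}) : A \subset cls q b ->
  X \subset cls 1 b -> addP G U A X \subset cls 1 b.
Proof.
move=> /cls_sub sA sX; rewrite finset.subUset sX; apply/fintype.subsetP => k.
rewrite !inE => /andP[/bigcupP[j jA]]; rewrite inE => /andP[kU kj] /andP[_ qk].
have [jU sj] := sA _ jA; rewrite kU qk/= -sj.
by rewrite (s_edge kU jU kj) (eqP qk) oner_eq0 addbF.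
Qed.

Let addD_sub q b (A X : {set 'I_N}) : A \subset cls q b ->
  X \subset cls 0 (~~ b) -> addD G U A X \subset cls 0 (~~ b).
Proof.
move=> /cls_sub sA sX; rewrite finset.subUset sX; apply/fintype.subsetP => k.
rewrite !inE => /andP[/bigcupP[j jA]]; rewrite inE => /andP[kU kj] /andP[_ qk].
have [jU sj] := sA _ jA; rewrite kU qk/= -sj.
by rewrite (s_edge kU jU kj) qk addbT negbK.
Qed.

Let round_sorted e : sorted_by_sign e -> sorted_by_sign (round G U e).
Proof.
have u1 e' : sorted_by_sign e' -> sorted_by_sign (update1 G U e').
  case/and4P=> *; apply/and4P; split=> //=; first exact: (addP_sub (q := 1)).
  exact: (@addD_sub 1 false).
have u2 e' : sorted_by_sign e' -> sorted_by_sign (update2 G U e').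
  case/and4P=> *; apply/and4P; split=> //=; first exact: (addP_sub (q := 0)).
  exact: (@addD_sub 0 true).
have u3 e' : sorted_by_sign e' -> sorted_by_sign (update3 G U e').
  case/and4P=> *; apply/and4P; split=> //=; first exact: (addP_sub (q := 0)).
  exact: (@addD_sub 0 false).
have u4 e' : sorted_by_sign e' -> sorted_by_sign (update4 G U e').
  case/and4P=> *; apply/and4P; split=> //=; first exact: (addP_sub (q := 1)).
  exact: (@addD_sub 1 true).
by move=> /u1/u2/u3/u4.
Qed.

Let sorted_disjoint e : sorted_by_sign e -> mutually_disjoint e.
Proof.
have dis q b q' b' (A B : {set 'I_N}) :
    A \subset cls q b -> B \subset cls q' b' -> (q, b) != (q', b') ->
    [disjoint A & B]%B.
  move=> /fintype.subsetP sA /fintype.subsetP sB ne.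
  rewrite -finset.setI_eq0; apply/eqP/finset.setP => i.
  rewrite inE finset.in_set0; apply/negP => /andP[/sA + /sB]; rewrite !inE.
  move=> /and3P[_ /eqP qi /eqP si] /and3P[_ /eqP qi' /eqP si'].
  by rewrite -qi -qi' -si -si' eqxx in ne.
have n01 : (1 : R) != 0 by exact: oner_neq0.
case/and4P=> sP1 sP2 sD1 sD2; rewrite /mutually_disjoint.
rewrite (dis _ _ _ _ _ _ sP1 sP2) ?(dis _ _ _ _ _ _ sP1 sD1)
  ?(dis _ _ _ _ _ _ sP1 sD2) ?(dis _ _ _ _ _ _ sP2 sD1)
  ?(dis _ _ _ _ _ _ sP2 sD2) ?(dis _ _ _ _ _ _ sD1 sD2)//.
all: by rewrite xpair_eqE ?eqxx//= (negPf n01).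
Qed.

Let sorted_reassigned e e' : sorted_by_sign e -> sorted_by_sign e' ->
  ~ reassigned e e'.
Proof.
case/and4P=> /cls_sub P1 /cls_sub P2 /cls_sub D1 /cls_sub D2.
case/and4P=> /cls_sub P1' /cls_sub P2' /cls_sub D1' /cls_sub D2'.
case=> i /or4P[]/andP[].
- by move=> /P1[_ +] /P2'[_ +] => -> .
- by move=> /P2[_ +] /P1'[_ +] => -> .
- by move=> /D1[_ +] /D2'[_ +] => -> .
- by move=> /D2[_ +] /D1'[_ +] => -> .
Qed.

Let sorted_cover e : sorted_by_sign e -> cover e \subset U.
Proof.
have sub q b : cls q b \subset U by apply/fintype.subsetP => i; rewrite inE => /andP[].
case/and4P=> sP1 sP2 sD1 sD2; rewrite !finset.subUset.
by rewrite !(fintype.subset_trans sP1, fintype.subset_trans sP2,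
  fintype.subset_trans sD1, fintype.subset_trans sD2) ?sub.
Qed.

Let round_cover e : cover e \subset cover (round G U e).
Proof.
apply/fintype.subsetP => i; rewrite !inE /=.
by move=> /orP[/orP[/orP[]|]|] ->; rewrite ?orbT.
Qed.

Let round_in_nbr e i k : i \in cover e -> k \in U -> edge G k i ->
  k \in cover (round G U e).
Proof.
move=> ie kU ki.
have nb (A : {set 'I_N}) : i \in A -> k \in in_nbrs_on G U A.
  by move=> iA; apply/bigcupP; exists i; rewrite // inE kU.
have pd : (k \in pref G U) || (k \in depref G U).
  by rewrite !inE kU /=; case: (q01 kU) => ->; rewrite eqxx ?orbT.
rewrite !finset.in_setU in ie.
rewrite /cover/= /addP /addD !(finset.in_setU, finset.in_setI).
case/orP: ie => [/orP[/orP[]|]|] ie.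
- rewrite (nb (eP1 e))//.
  by case/orP: pd => ->; rewrite ?orbT.
- rewrite [k \in in_nbrs_on _ _ (eP2 e :|: _)%SET]nb ?finset.in_setU ?ie//.
  by case/orP: pd => ->; rewrite ?orbT.
- rewrite [k \in in_nbrs_on _ _ (eD1 e :|: _)%SET]nb ?finset.in_setU ?ie//.
  by case/orP: pd => ->; rewrite ?orbT.
- rewrite [k \in in_nbrs_on _ _ (eD2 e :|: _)%SET]nb ?finset.in_setU ?ie//.
  by case/orP: pd => ->; rewrite ?orbT.
Qed.

Hypothesis conn : strongly_connected_on G U.

Let round_grows e : sorted_by_sign e -> cover e != finset.set0 -> cover e != U ->
  cover e \proper cover (round G U e).
Proof.
move=> se /finset.set0Pn[j je] neU.
have := neU; rewrite finset.eqEsubset sorted_cover//= => /fintype.subsetPn[k0 k0U k0e].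
have [i [k [ie kU kne ki]]] : exists i k,
    [/\ i \in cover e, k \in U, k \notin cover e & edge G k i].
  apply: contrapT => noedge.
  have jU : j \in U by exact: (fintype.subsetP (sorted_cover se)).
  move: je; apply/negP.
  apply: (connect_closed_ind (Q := fun x => x \notin cover e) _ (conn k0U jU)) => //.
  move=> x y /and3P[xU yU xy] xe; apply/negP => ye.
  by apply: noedge; exists y, x.
apply/fintype.properP; split; first exact: round_cover.
by exists k => //; exact: round_in_nbr ie kU ki.
Qed.

Let sorted_succeeds e : sorted_by_sign e -> cover e != finset.set0 ->
  explore_succeeds G U e.
Proof.
have [n] := ubnP (N - #|cover e|)%N; elim: n => // n IH in e * => len se e0.
have [eU|neU] := eqVneq (cover e) U.
  by apply: Explore_final => //; apply: sorted_reassigned => //; exact: round_sorted.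
have grow := round_grows se e0 neU.
apply: Explore_loop; first exact/eqP.
  by apply/sorted_disjoint/round_sorted.
apply: IH; last 2 first.
- exact: round_sorted.
- by rewrite -finset.proper0; apply: fintype.sub_proper_trans grow; exact: finset.sub0set.
have := proper_card grow; have := max_card (cover (round G U e)).
rewrite card_ord; move: len; set a := #|_|; set b := #|_|; lia.
Qed.

Lemma explore_init_succeeds j : j \in U -> s j = (q_ G j == 0) ->
  explore_succeeds G U (explore_init G U j).
Proof.
move=> jU sj; apply: sorted_succeeds.
  rewrite /sorted_by_sign /explore_init; case: ifPn; rewrite inE jU/=.
    move=> qj; rewrite /= !finset.sub0set !andbT finset.sub1set inE jU qj sj.
    by rewrite (eqP qj) oner_eq0.
  move=> qj; rewrite /= !finset.sub0set !andbT/= finset.sub1set inE jU sj.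
  by case: (q01 jU) qj => -> ; rewrite eqxx.
apply/finset.set0Pn; exists j; rewrite /explore_init.
by case: ifP => _; rewrite !inE eqxx ?orbT.
Qed.

End Exploration.

Lemma consistent_signs_partition (R : realType) (N : nat) (G : urn_network R N)
    (U : {set 'I_N}) (s : 'I_N -> bool) :
  {in U, forall i, q_ G i = 0 \/ q_ G i = 1} ->
  {in U &, forall j i, edge G j i -> s i = s j (+) (q_ G j == 0)} ->
  strongly_connected_on G U -> admits_graph_partition G U.
Proof.
move=> q01 sE conn j jU.
apply: (@explore_init_succeeds _ _ _ _ _ (fun i => s i (+) s j (+) (q_ G j == 0))) => //.
  by move=> a b aU bU ab; rewrite (sE a b)//; case: (s a); case: (s j); do 2 case: eqP.
by rewrite addbb addFb.
Qed.

(** * Slowly varying sequences *)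

Lemma sum_closed (R : nmodType) (T : Type) (C : (T -> R) -> Prop) : C (fun=> 0) ->
  (forall f g, C f -> C g -> C (fun w => f w + g w)) ->
  forall (I : Type) (s : seq I) (Q : pred I) (h : I -> T -> R),
  (forall i, Q i -> C (h i)) -> C (fun w => \sum_(i <- s | Q i) h i w).
Proof.
move=> C0 CD I s Q h Ch; elim: s => [|i s IH].
  by rewrite (_ : (fun w => _) = fun=> 0)//; apply/funext => w; rewrite big_nil.
have [Qi|nQi] := boolP (Q i).
  rewrite (_ : (fun w => _) = fun w => h i w + \sum_(j <- s | Q j) h j w).
    by apply: CD => //; exact: Ch.
  by apply/funext => w; rewrite big_cons Qi.
rewrite (_ : (fun w => _) = fun w => \sum_(j <- s | Q j) h j w)//.
by apply/funext => w; rewrite big_cons (negPf nQi).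
Qed.

Definition slowly_varying (R : realType) (u : nat -> R) : Prop :=
  exists C : R, forall t, `|u t| <= C /\ `|u t.+1 - u t| <= C / t.+1%:R.

Section SlowlyVarying.
Variable R : realType.
Implicit Types u v : nat -> R.

Lemma slowly_varying_cst (c : R) : slowly_varying (fun=> c).
Proof.
by exists `|c| => t; rewrite subrr normr0 divr_ge0.
Qed.

Lemma slowly_varyingD u v : slowly_varying u -> slowly_varying v ->
  slowly_varying (fun t => u t + v t).
Proof.
move=> [C Cu] [D Dv]; exists (C + D) => t; have [u1 u2] := Cu t.
have [v1 v2] := Dv t; split.
  by rewrite (le_trans (ler_normD _ _))// lerD.
rewrite opprD addrACA (le_trans (ler_normD _ _))// mulrDl lerD//.
Qed.

Lemma slowly_varyingM u v : slowly_varying u -> slowly_varying v ->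
  slowly_varying (fun t => u t * v t).
Proof.
move=> [C Cu] [D Dv].
have C0 : 0 <= C by have [+ _] := Cu 0%N; exact: le_trans.
have D0 : 0 <= D by have [+ _] := Dv 0%N; exact: le_trans.
exists (2 * C * D) => t; have [u1 u2] := Cu t; have [v1 v2] := Dv t.
have [w1 _] := Cu t.+1; split.
  rewrite normrM (@le_trans _ _ (C * D))//; first exact: ler_pM.
  by have := mulr_ge0 C0 D0; lra.
have -> : u t.+1 * v t.+1 - u t * v t =
  u t.+1 * (v t.+1 - v t) + (u t.+1 - u t) * v t by ring.
rewrite (le_trans (ler_normD _ _))// !normrM.
have -> : 2 * C * D / t.+1%:R = C * (D / t.+1%:R) + C / t.+1%:R * D by ring.
by rewrite lerD// ler_pM.
Qed.

Lemma slowly_varyingN u : slowly_varying u -> slowly_varying (fun t => - u t).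
Proof.
move=> [C Cu]; exists C => t; have [u1 u2] := Cu t.
by rewrite normrN -opprD normrN.
Qed.

Lemma slowly_varying_sum (I : finType) (P : pred I) (u : I -> nat -> R) :
  (forall i, P i -> slowly_varying (u i)) ->
  slowly_varying (fun t => \sum_(i | P i) u i t).
Proof.
exact: (sum_closed (slowly_varying_cst 0) slowly_varyingD).
Qed.

(* If [u t >= eps], then [u] stays above [eps / 2] on a block of length
   proportional to [t], whose logarithmic mass is bounded below. *)
Lemma slowly_varying_block u (C eps : R) (p t : nat) : (0 < p)%N -> 0 < C ->
  C / p%:R <= eps / 2 -> (forall t, 0 <= u t) ->
  (forall t, `|u t.+1 - u t| <= C / t.+1%:R) -> (p <= t)%N -> eps <= u t ->
  exists K : nat, (eps / 2) / (2 * p + 1)%:R <=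
    series (fun t => u t / t.+1%:R) (t + K)%N - series (fun t => u t / t.+1%:R) t.
Proof.
move=> p0 C0 Cp u0 Cu pt epsu; pose K := (t.+1 %/ p)%N; exists K.
have eps0 : 0 < eps by have : 0 < C / p%:R by [rewrite divr_gt0// ltr0n]; lra.
have K1 : (1 <= K)%N by rewrite divn_gt0// leqW.
have Kp : (K * p <= t.+1)%N by exact: leq_divM.
have Kt : (t.+1 + K <= K * (2 * p + 1))%N.
  have : (t.+1 < p * K.+1)%N by rewrite mulnC ltn_ceil.
  have : (p <= p * K)%N by rewrite leq_pmulr.
  rewrite mulnDr muln1 mulnS mulnCA mul2n -addnn (mulnC K); lia.
have ulow k : (k <= K)%N -> eps - C * k%:R / t.+1%:R <= u (t + k)%N.
  elim: k => [_|k IH kK]; first by rewrite mulr0 mul0r subr0 addn0.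
  have := IH (ltnW kK); have := Cu (t + k)%N; rewrite ler_norml => /andP[+ _].
  have : C / (t + k).+1%:R <= C / t.+1%:R.
    by rewrite ler_pM2l// lef_pV2 ?posrE// ler_nat ltnS leq_addr.
  have -> : C * k.+1%:R / t.+1%:R = C * k%:R / t.+1%:R + C / t.+1%:R.
    by rewrite -natr1; ring.
  rewrite addnS; move: (_ / t.+1%:R) (C / t.+1%:R) (C / _) (u _) (u _).
  by move=> *; lra.
have ulow2 k : (k < K)%N -> eps / 2 <= u (t + k)%N.
  move=> kK; apply: le_trans (ulow k (ltnW kK)).
  suff : C * k%:R / t.+1%:R <= C / p%:R.
    by move: Cp; move: (_ / t.+1%:R) (C / _) => *; lra.
  rewrite -mulrA ler_pM2l// ler_pdivrMr// mulrC ler_pdivlMr ?ltr0n// -natrM ler_nat.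
  by apply: leq_trans Kp; rewrite leq_mul2r ltnW// orbT.
set S := series _.
have Slow k : (k <= K)%N -> k%:R * ((eps / 2) / (t.+1 + K)%:R) <= S (t + k)%N - S t.
  elim: k => [_|k IH kK]; first by rewrite mul0r addn0 subrr.
  rewrite addnS /S seriesSr -/S -natr1 mulrDl mul1r addrAC.
  rewrite lerD ?IH ?(ltnW kK)// ler_pM ?ulow2//; first by lra.
  by rewrite lef_pV2 ?posrE// ler_nat addSn ltnS leq_add2l ltnW.
apply: le_trans (Slow K (leqnn _)).
rewrite mulrCA ler_pM2l ?divr_gt0// ler_pdivlMr ?ltr0n//.
have p20 : 0 < (2 * p + 1)%:R :> R by rewrite ltr0n addn1.
by rewrite mulrC ler_pdivrMr// -natrM ler_nat.
Qed.

Lemma slowly_varying_cvg0 u : (forall t, 0 <= u t) -> slowly_varying u ->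
  cvgn (series (fun t => u t / t.+1%:R)) -> u @ \oo --> 0.
Proof.
move=> u0 [C0 Cu0] cvgS.
have [C Cgt0 Cu] : exists2 C : R, 0 < C & forall t, `|u t.+1 - u t| <= C / t.+1%:R.
  exists (`|C0| + 1); first by rewrite ltr_wpDl.
  move=> t; have [_ /le_trans->//] := Cu0 t.
  by rewrite ler_pM2r ?invr_gt0// ler_wpDr// ler_norm.
suff near_small (eps : R) : 0 < eps -> \forall t \near \oo, `|u t| < eps.
  by apply/cvgr0Pnorm_lt => eps /near_small.
move=> eps0; pose p := (Num.truncn (2 * C / eps)).+1.
have Cp : C / p%:R <= eps / 2.
  have := truncnS_gt (2 * C / eps); rewrite -/p.
  rewrite ltr_pdivrMr// ler_pdivrMr// => /ltW; lra.
set S := series _ in cvgS.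
pose del : R := (eps / 2) / (2 * p + 1)%:R.
have del0 : 0 < del by rewrite !divr_gt0// ltr0n addn1.
have /cvgrPdist_lt /(_ (del / 2)) := cvgS; rewrite divr_gt0// => /(_ isT).
move=> [n0 _ Sn0]; exists (maxn n0 p) => // t; rewrite /= geq_max => /andP[n0t pt].
rewrite ger0_norm// ltNge; apply/negP => epsu.
have [K] := slowly_varying_block (ltn0Sn _) Cgt0 Cp u0 Cu pt epsu.
have := Sn0 t n0t; have := Sn0 (t + K)%N (leq_trans n0t (leq_addr _ _)).
rewrite /= -/S -/del !ltr_norml => /andP[? ?] /andP[? ?]; lra.
Qed.

End SlowlyVarying.

(** * One path of the urn process *)

Section UrnPath.
Variables (R : realType) (N : nat) (G : urn_network R N).
Variable x : nat -> 'I_N -> bool.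

Let z t i : R := fraction G x t i.

Lemma white_black_total t i :
  (white G x t i + black G x t i = W0 G i + B0 G i + t * mbar G i)%N.
Proof.
elim: t => [|t IH]; first by rewrite mul0n addn0.
rewrite /= addnACA {}IH -big_split/= mulSn (addnC (mbar G i)) addnA.
congr (_ + _)%N; apply: eq_bigr => j _.
by have := alpha_le G j; have := beta_le G j; case: (x t.+1 j) => /=; lia.
Qed.

Lemma total_gt0 t i : (0 < white G x t i + black G x t i)%N.
Proof. by rewrite white_black_total ltn_addr// T0_gt0. Qed.

Lemma fraction_ge0 t i : 0 <= z t i.
Proof. by rewrite divr_ge0. Qed.

Lemma fraction_le1 t i : z t i <= 1.
Proof.
by rewrite ler_pdivrMr ?ltr0n ?total_gt0// mul1r ler_nat leq_addr.
Qed.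

Lemma mbar_gt0 i : i \in flexible G -> 0 < (mbar G i)%:R :> R.
Proof.
rewrite !inE => /finset.set0Pn[j ji]; rewrite ltr0n /mbar (bigD1 j)//= ltn_addr//.
exact: m_ge1.
Qed.

Lemma fraction_stubborn t i : i \in stubborn G -> z t i = Z0 G i.
Proof.
rewrite inE => /eqP Ni.
have w : white G x t i = W0 G i.
  by elim: t => //= t ->; rewrite Ni finset.big_set0 addn0.
have b : black G x t i = B0 G i.
  by elim: t {w} => //= t ->; rewrite Ni finset.big_set0 addn0.
by rewrite /z /fraction w b.
Qed.

Definition draw t j : R := q_ G j * z t j + (1 - q_ G j) * (1 - z t j).

Definition noise t i : R :=
  (mbar G i)%:R^-1 * \sum_(j in in_nbr G i) r_ G j * ((x t.+1 j)%:R - draw t j).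

Definition drift (y : 'I_N -> R) i : R :=
  (mbar G i)%:R^-1 *
    \sum_(j in in_nbr G i) ((2 * q_ G j - 1) * r_ G j * y j +
                            ((alpha_ G j)%:R - q_ G j * r_ G j)) - y i.

Let delay i : R := (W0 G i + B0 G i)%:R / (mbar G i)%:R.

Lemma delay_ge0 i : 0 <= delay i.
Proof. by rewrite divr_ge0. Qed.

Lemma white_increment t i : ((white G x t.+1 i)%:R : R) = (white G x t i)%:R +
  \sum_(j in in_nbr G i) (r_ G j * (x t.+1 j)%:R + ((m_ G j)%:R - (beta_ G j)%:R)).
Proof.
rewrite /= natrD natr_sum; congr (_ + _); apply: eq_bigr => j _.
rewrite /r_; have := beta_le G j; case: (x t.+1 j) => ?.
  by rewrite /= muln1 subnn muln0 addn0 mulr1; ring.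
by rewrite /= muln0 subn0 muln1 add0n natrB// mulr0; ring.
Qed.

Lemma drift_noise_increment t i :
  drift (z t) i + noise t i = (mbar G i)%:R^-1 *
    ((white G x t.+1 i)%:R - (white G x t i)%:R) - z t i.
Proof.
rewrite white_increment /drift /noise addrAC; congr (_ - _).
rewrite -mulrDr; congr (_ * _); rewrite [RHS]addrAC subrr add0r -big_split/=.
by apply: eq_bigr => j _; rewrite /draw /r_; ring.
Qed.

Lemma increment_itv t i : i \in flexible G -> `|drift (z t) i + noise t i| <= 1.
Proof.
move=> iF; rewrite drift_noise_increment.
have m0 := mbar_gt0 iF.
have y0 : 0 <= (mbar G i)%:R^-1 * ((white G x t.+1 i)%:R - (white G x t i)%:R) :> R.
  by rewrite mulr_ge0 ?invr_ge0// subr_ge0 ler_nat /= leq_addr.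
have y1 : (mbar G i)%:R^-1 * ((white G x t.+1 i)%:R - (white G x t i)%:R) <= 1 :> R.
  rewrite mulrC ler_pdivrMr// mul1r lerBlDr -natrD ler_nat.
  have := white_black_total t i; have := white_black_total t.+1 i.
  have : (black G x t i <= black G x t.+1 i)%N by rewrite /= leq_addr.
  by rewrite mulSn; lia.
have := fraction_ge0 t i; have := fraction_le1 t i; rewrite ler_norml.
by move: (_ * _) y0 y1 => y ? ? ? ?; apply/andP; split; lra.
Qed.

Lemma fraction_step t i : i \in flexible G ->
  z t.+1 i - z t i = (drift (z t) i + noise t i) / (t.+1%:R + delay i).
Proof.
move=> iF; have m0 := mbar_gt0 iF; rewrite drift_noise_increment.
have T t' : ((white G x t' i + black G x t' i)%:R : R) =
    (mbar G i)%:R * (t'%:R + delay i).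
  by rewrite white_black_total natrD natrM /delay; field; rewrite gt_eqF.
rewrite /z /fraction !T.
have := delay_ge0 i; rewrite le_eqVlt => d0.
have t0 : t%:R + delay i != 0.
  have := total_gt0 t i; rewrite -(ltr0n R) T pmulr_rgt0// => /gt_eqF ->//.
have t1 : t.+1%:R + delay i != 0.
  have := total_gt0 t.+1 i; rewrite -(ltr0n R) T pmulr_rgt0// => /gt_eqF ->//.
rewrite -natr1 in t1 *; field.
by rewrite t0 t1 gt_eqF.
Qed.

Lemma fraction_step_le t i : i \in flexible G ->
  `|z t.+1 i - z t i| <= 1 / t.+1%:R.
Proof.
move=> iF; rewrite fraction_step// normrM ler_pM ?increment_itv//.
rewrite ger0_norm ?invr_ge0 ?addr_ge0 ?delay_ge0//.
by rewrite lef_pV2 ?posrE ?ltr_wpDr ?lerDl ?delay_ge0.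
Qed.

Lemma sqr_step t i c : i \in flexible G ->
  (z t.+1 i - c) ^+ 2 <= (z t i - c) ^+ 2 +
    2 / t.+1%:R * ((z t i - c) * (drift (z t) i + noise t i)) +
    (2 * (1 + `|c|) * delay i + 1) / t.+1%:R ^+ 2.
Proof.
move=> iF; have ui := increment_itv t iF; have step := fraction_step t iF.
have d0 := delay_ge0 i.
set u := drift _ _ + _ in ui step *; set e := z t i - c; set T : R := t.+1%:R.
have T0 : 0 < T by rewrite ltr0n.
have e1 : `|e| <= 1 + `|c|.
  rewrite (le_trans (ler_normB _ _))// lerD2r ger0_norm ?fraction_ge0//.
  exact: fraction_le1.
have -> : (z t.+1 i - c) ^+ 2 =
    e ^+ 2 + 2 * e * (z t.+1 i - z t i) + (z t.+1 i - z t i) ^+ 2.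
  by rewrite /e; ring.
have sq : (z t.+1 i - z t i) ^+ 2 <= 1 / T ^+ 2.
  have h := fraction_step_le t iF; rewrite -/T in h.
  rewrite -(real_normK (num_real _)) -[1 in leRHS](expr1n R 2) -expr_div_n.
  by rewrite ler_sqr ?nnegrE// divr_ge0// ltW.
have cross : 2 * e * (z t.+1 i - z t i) <=
    2 / T * (e * u) + 2 * (1 + `|c|) * delay i / T ^+ 2.
  rewrite step -/T.
  have -> : 2 * e * (u / (T + delay i)) =
      2 / T * (e * u) - 2 * (e * u) * (delay i / (T * (T + delay i))).
    by field; rewrite !gt_eqF// ltr_wpDr.
  rewrite lerD2l -mulNr.
  have eu : - (2 * (e * u)) <= 2 * (1 + `|c|).
    rewrite -mulrN ler_pM2l// (le_trans (ler_norm _))// normrN normrM.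
    by rewrite -[leRHS]mulr1 ler_pM.
  have : delay i / (T * (T + delay i)) <= delay i / T ^+ 2.
    rewrite ler_wpM2l// lef_pV2 ?posrE ?mulr_gt0 ?exprn_gt0 ?ltr_wpDr// expr2.
    by rewrite ler_pM2l// lerDl.
  move=> h; rewrite -[leRHS]mulrA.
  have c0 : 0 <= 2 * (1 + `|c|) by rewrite mulr_ge0// addr_ge0.
  apply: (le_trans (y := 2 * (1 + `|c|) * (delay i / (T * (T + delay i))))).
    by rewrite ler_wpM2r// divr_ge0// mulr_ge0 ?addr_ge0// ltW.
  by rewrite ler_wpM2l.
rewrite -!addrA lerD2l (le_trans (lerD cross sq))// -addrA lerD2l.
by rewrite -[leLHS]mulrDl.
Qed.

End UrnPath.

(** * The coupling matrix of the network *)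

Section Coupling.
Variables (R : realType) (N : nat) (G : urn_network R N).
Let F := flexible G.

Definition coupling (i j : 'I_N) : R :=
  if j \in in_nbr G i then (m_ G j)%:R / (mbar G i)%:R else 0.

Definition bias (j : 'I_N) : R := (2 * q_ G j - 1) * r_ G j / (m_ G j)%:R.

Lemma m_gt0 j : 0 < (m_ G j)%:R :> R.
Proof. by rewrite ltr0n; exact: m_ge1. Qed.

Lemma coupling_ge0 i j : 0 <= coupling i j.
Proof. by rewrite /coupling; case: ifP => // _; rewrite divr_ge0. Qed.

Lemma coupling_gt0 i j : i \in F -> (0 < coupling i j) = edge G j i.
Proof.
move=> iF; rewrite /coupling inE; case: ifP => _; last by rewrite ltxx.
by rewrite divr_gt0 ?m_gt0 ?mbar_gt0.
Qed.

Lemma coupling_row i : i \in F -> \sum_j coupling i j = 1.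
Proof.
move=> iF; rewrite -big_mkcond/= -mulr_suml -natr_sum.
by rewrite divff// gt_eqF// mbar_gt0.
Qed.

Lemma coupling_row_flexible i : i \in F ->
  \sum_(j in F) coupling i j = 1 - \sum_(j in stubborn G) coupling i j.
Proof.
move=> iF; rewrite -(coupling_row iF) [in RHS](bigID (mem F))/=.
by rewrite [X in _ = _ + X - _](eq_bigl (mem (stubborn G))) ?addrK// => j;
  rewrite !inE negbK.
Qed.

Lemma coupling_row_le1 : {in F, forall i, \sum_(j in F) coupling i j <= 1}.
Proof.
move=> i iF; rewrite coupling_row_flexible// gerBl sumr_ge0// => j _.
exact: coupling_ge0.
Qed.

Lemma coupling_row_lt1 i j : i \in F -> j \in stubborn G -> edge G j i ->
  \sum_(j in F) coupling i j < 1.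
Proof.
move=> iF jS ji; rewrite coupling_row_flexible// gtrBl (bigD1 j)//=.
rewrite ltr_wpDr ?coupling_gt0// sumr_ge0// => k _; exact: coupling_ge0.
Qed.

Lemma normr_r j : `|r_ G j| <= (m_ G j)%:R.
Proof.
rewrite /r_ ler_norml; apply/andP; split.
  by rewrite lerBrDr addrC subrr addr_ge0.
by rewrite lerBlDr lerD// ler_nat ?alpha_le ?beta_le.
Qed.

Lemma normr_r_non_polya j : non_polya_type G j -> `|r_ G j| < (m_ G j)%:R.
Proof.
move=> /andP[ab0 ab2]; rewrite /r_ ltr_norml; apply/andP; split.
  by rewrite ltrBrDr addrC subrr -natrD ltr0n.
by rewrite ltrBlDr -!natrD ltr_nat addnn -mul2n.
Qed.

Lemma normr_q j : `|2 * q_ G j - 1| <= 1.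
Proof.
by have /andP[? ?] := q_itv G j; rewrite ler_norml; apply/andP; split; lra.
Qed.

Lemma bias_norm j : `|bias j| = `|2 * q_ G j - 1| * (`|r_ G j| / (m_ G j)%:R).
Proof. by rewrite /bias !normrM normfV normr_nat mulrA. Qed.

Lemma bias_le1 j : `|bias j| <= 1.
Proof.
rewrite bias_norm -[leRHS]mulr1 ler_pM ?divr_ge0 ?normr_q//.
by rewrite ler_pdivrMr ?m_gt0// mul1r normr_r.
Qed.

Lemma bias_lt1 j : 0 < q_ G j < 1 \/ non_polya_type G j -> `|bias j| < 1.
Proof.
rewrite bias_norm => -[q01|np].
  apply: (@le_lt_trans _ _ `|2 * q_ G j - 1|).
    rewrite -[leRHS]mulr1 ler_wpM2l// ler_pdivrMr ?m_gt0// mul1r; exact: normr_r.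
  by case/andP: q01 => ? ?; rewrite ltr_norml; apply/andP; split; lra.
apply: (@le_lt_trans _ _ (`|r_ G j| / (m_ G j)%:R)).
  by rewrite -[leRHS]mul1r ler_wpM2r ?divr_ge0 ?normr_q.
by rewrite ltr_pdivrMr ?m_gt0// mul1r; exact: normr_r_non_polya.
Qed.

Lemma bias_polya j : polya_type G j -> bias j = 2 * q_ G j - 1.
Proof.
move=> [aj bj]; rewrite /bias /r_ aj bj addrK mulfK// gt_eqF// m_gt0 //.
Qed.

Lemma coupling_bias_sum (y : 'I_N -> R) i : i \in F ->
  \sum_(j in F) coupling i j * bias j * y j =
  (mbar G i)%:R^-1 * \sum_(j in (F :&: in_nbr G i)%SET)
     (2 * q_ G j - 1) * r_ G j * y j.
Proof.
move=> iF; rewrite mulr_sumr.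
under [RHS]eq_bigl do rewrite finset.in_setI.
rewrite big_mkcondr/=; apply: eq_bigr => j jF.
rewrite /coupling; case: ifP => // _; last by rewrite !mul0r.
by rewrite /bias; field; rewrite !gt_eqF ?m_gt0 ?mbar_gt0.
Qed.

Lemma drift_centered (muF mu0 c : R) (y : 'I_N -> R) i :
  i \in F -> (forall j, j \in stubborn G -> y j = Z0 G j) ->
  (mbar G i)%:R^-1 * (\sum_(j in (F :&: in_nbr G i)%SET)
     (2 * q_ G j - 1) * r_ G j) = muF ->
  (mbar G i)%:R^-1 *
    (\sum_(j in (stubborn G :&: in_nbr G i)%SET)
       Z0 G j * (2 * q_ G j - 1) * r_ G j
     + \sum_(j in in_nbr G i) ((alpha_ G j)%:R - q_ G j * r_ G j)) = mu0 ->
  c = muF * c + mu0 ->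
  drift G y i =
    - ((y i - c) - \sum_(j in F) coupling i j * bias j * (y j - c)).
Proof.
move=> iF yS e1 e2 ec.
have split_nbr (f : 'I_N -> R) : \sum_(j in in_nbr G i) f j =
    \sum_(j in (F :&: in_nbr G i)%SET) f j +
    \sum_(j in (stubborn G :&: in_nbr G i)%SET) f j.
  rewrite (bigID (mem F))/=; congr (_ + _); apply: eq_bigl => j.
    by rewrite !inE andbC.
  by rewrite !inE negbK andbC.
have -> : \sum_(j in F) coupling i j * bias j * (y j - c) =
    (mbar G i)%:R^-1 * \sum_(j in (F :&: in_nbr G i)%SET)
      (2 * q_ G j - 1) * r_ G j * y j - muF * c.
  rewrite coupling_bias_sum// -e1 -mulrA mulr_suml -mulrBr -sumrB.
  by congr (_ * _); apply: eq_bigr => j _; ring.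
rewrite /drift big_split/= split_nbr.
rewrite [X in _ * (_ + X + _)](eq_bigr (fun j => Z0 G j * (2 * q_ G j - 1) * r_ G j)).
  have mu0E : mu0 = c - muF * c by rewrite {1}ec addrAC subrr add0r.
  by rewrite -addrA mulrDr e2 mu0E; ring.
by move=> j /finset.setIP[jS _]; rewrite yS//; ring.
Qed.

Hypothesis Hweak : weakly_connected G.
Hypothesis Hstrong : strongly_connected_on G F.

Lemma coupling_conn : {in F &, forall j i,
  connect [rel x y | [&& x \in F, y \in F & 0 < coupling y x]] j i}.
Proof.
move=> j i jF iF; have := Hstrong jF iF; apply: connect_sub => a b /=.
move=> /and3P[aF bF ab]; apply: connect1 => /=.
by rewrite aF bF coupling_gt0.
Qed.

Lemma stubborn_out_edge j : j \in stubborn G -> F != finset.set0 ->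
  exists2 i, i \in F & edge G j i.
Proof.
move=> jS /finset.set0Pn[i iF].
apply: contrapT => noedge; suff ij : i = j by rewrite ij !inE in iF jS; rewrite jS in iF.
apply: (connect_closed_ind (Q := fun k => k = j) _ (Hweak j i)) => // a b /= + aj.
rewrite {a}aj => /orP[jb|bj].
  case: noedge; exists b => //; rewrite !inE; apply/finset.set0Pn; exists j.
  by rewrite inE.
move: jS; rewrite inE => /eqP/finset.setP/(_ b).
by rewrite !inE bj.
Qed.

Lemma flexible_out_edge j : stubborn G = finset.set0 ->
  exists2 i, i \in F & edge G j i.
Proof.
move=> S0; have allF i : i \in F by rewrite inE S0 inE.
have := allF j; rewrite !inE => /finset.set0Pn[k]; rewrite inE => kj.
have := Hstrong (allF j) (allF k) => /connectP[[|i p]] /=.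
  by move=> _ kE; exists j => //; rewrite -{1}kE.
by move=> /andP[/and3P[_ iF ji] _] _; exists i.
Qed.

Lemma coupling_nondegenerate (Hcond :
     (exists i, 0 < q_ G i < 1) \/
     (exists2 i, i \in F & non_polya_type G i) \/
     stubborn G <> finset.set0 \/
     [/\ forall i, q_ G i = 0 \/ q_ G i = 1,
         forall i, i \in F -> polya_type G i
       & ~ admits_graph_partition G F]) : F != finset.set0 ->
  (exists2 i, i \in F & \sum_(j in F) coupling i j < 1) \/
  (exists i j, [/\ i \in F, j \in F, 0 < coupling i j & `|bias j| < 1]) \/
  (forall s : 'I_N -> bool, exists i j,
    [/\ i \in F, j \in F, 0 < coupling i j & s i != s j (+) (bias j < 0)]).
Proof.
move=> F0; have [S0|/finset.set0Pn[j jS]] := eqVneq (stubborn G) finset.set0; last first.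
  left; have [i iF ji] := stubborn_out_edge jS F0.
  by exists i => //; exact: coupling_row_lt1 ji.
right; have allF i : i \in F by rewrite inE S0 inE.
have strict j : 0 < q_ G j < 1 \/ non_polya_type G j ->
    exists i j, [/\ i \in F, j \in F, 0 < coupling i j & `|bias j| < 1].
  move=> Hj; have [i iF ji] := flexible_out_edge j S0.
  by exists i, j; split; rewrite ?coupling_gt0//; exact: bias_lt1.
case: Hcond => [[j qj]|[[j _ nj]|[//|[q01 pol noadm]]]].
- by left; apply: (strict j); left.
- by left; apply: (strict j); right.
right=> s; apply: contrapT => cons; apply: noadm.
apply: (consistent_signs_partition (s := s)) => // j i jF iF ji.
have -> : (q_ G j == 0) = (bias j < 0).
  rewrite bias_polya; last exact: pol.
  by case: (q01 j) => ->; rewrite ?eqxx ?oner_eq0; apply/esym; lra.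
apply/eqP; apply: contrapT => /negP ne; apply: cons; exists i, j; split=> //.
by rewrite coupling_gt0.
Qed.

End Coupling.

Lemma sum_inv_sqr_le (R : realFieldType) (n : nat) :
  \sum_(0 <= t < n) (t.+1%:R ^+ 2)^-1 <= 2 :> R.
Proof.
suff : \sum_(0 <= t < n) (t.+1%:R ^+ 2)^-1 <= 2 - 2 / n.+1%:R :> R.
  by move/le_trans; apply; rewrite gerBl divr_ge0.
elim: n => [|n IH]; first by rewrite big_nil divr1 subrr.
rewrite big_nat_recr//= (le_trans (lerD IH (lexx _)))//.
have n1 : n.+2%:R = n.+1%:R + 1 :> R by rewrite -natr1.
have n0 : 1 <= n.+1%:R :> R by rewrite ler1n.
rewrite n1; move: (n.+1%:R) n0 => a a1; have a0 : 0 < a by lra.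
rewrite -subr_ge0.
have -> : 2 - 2 / (a + 1) - (2 - 2 / a + (a ^+ 2)^-1) = (a - 1) / (a ^+ 2 * (a + 1)).
  by field; rewrite !gt_eqF//; lra.
by rewrite divr_ge0 ?subr_ge0// mulr_ge0 ?sqr_ge0//; lra.
Qed.

Section Potential.
Variables (R : realType) (N : nat) (G : urn_network R N).
Let F := flexible G.
Variables (p : 'I_N -> R) (c muF mu0 : R).
Hypothesis p0 : {in F, forall i, 0 < p i}.
Hypothesis pK : {in F, forall j, \sum_(i in F) p i * coupling G i j <= p j}.
Hypothesis cE : c = muF * c + mu0.
Hypothesis SC1 : forall i, i \in F ->
  (mbar G i)%:R^-1 * (\sum_(j in (F :&: in_nbr G i)%SET)
     (2 * q_ G j - 1) * r_ G j) = muF.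
Hypothesis SC2 : forall i, i \in F ->
  (mbar G i)%:R^-1 *
    (\sum_(j in (stubborn G :&: in_nbr G i)%SET)
       Z0 G j * (2 * q_ G j - 1) * r_ G j
     + \sum_(j in in_nbr G i) ((alpha_ G j)%:R - q_ G j * r_ G j)) = mu0.

Definition path_dissipation x t : R :=
  dissipation F (coupling G) (bias G) p (fun j => fraction G x t j - c).

Definition path_noise x t : R :=
  \sum_(i in F) p i * ((fraction G x t i - c) * noise G x t i).

Let delay i : R := (W0 G i + B0 G i)%:R / (mbar G i)%:R.

Definition potential_bound : R :=
  \sum_(i in F) p i * ((1 + `|c|) ^+ 2 + 2 * (2 * (1 + `|c|) * delay i + 1)).

Lemma path_dissipation_ge0 x t : 0 <= path_dissipation x t.
Proof.
apply: dissipation_ge0 => //; first exact: coupling_ge0.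
  exact: coupling_row_le1.
exact: bias_le1.
Qed.

Lemma drift_dissipation x t :
  \sum_(i in F) p i * ((fraction G x t i - c) *
     (drift G (fraction G x t) i + noise G x t i)) =
  path_noise x t - path_dissipation x t.
Proof.
rewrite -sumrB; apply: eq_bigr => i iF.
rewrite (drift_centered iF _ (SC1 iF) (SC2 iF) cE); last exact: fraction_stubborn.
by ring.
Qed.

Lemma potential_step x t :
  \sum_(i in F) p i * (fraction G x t.+1 i - c) ^+ 2 <=
  \sum_(i in F) p i * (fraction G x t i - c) ^+ 2 +
  2 / t.+1%:R * (path_noise x t - path_dissipation x t) +
  (\sum_(i in F) p i * (2 * (1 + `|c|) * delay i + 1)) / t.+1%:R ^+ 2.
Proof.
rewrite -drift_dissipation mulr_sumr mulr_suml -!big_split/=.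
apply: ler_sum => i iF.
have := ler_wpM2l (ltW (p0 iF)) (sqr_step x t c iF); rewrite -/(delay i).
by move/le_trans; apply; rewrite le_eqVlt; apply/orP; left; apply/eqP; ring.
Qed.

Lemma potential_sum x n :
  \sum_(0 <= t < n) 2 / t.+1%:R * path_dissipation x t <=
  potential_bound + \sum_(0 <= t < n) 2 / t.+1%:R * path_noise x t.
Proof.
pose C := \sum_(i in F) p i * (2 * (1 + `|c|) * delay i + 1).
pose V t := \sum_(i in F) p i * (fraction G x t i - c) ^+ 2.
have V0 t : 0 <= V t.
  by apply: sumr_ge0 => i iF; rewrite mulr_ge0 ?sqr_ge0 ?(ltW (p0 iF)).
have C0 : 0 <= C.
  apply: sumr_ge0 => i iF; rewrite mulr_ge0 ?(ltW (p0 iF))// addr_ge0//.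
  by rewrite !mulr_ge0 ?delay_ge0 ?addr_ge0 ?invr_ge0.
have telescope : V n + \sum_(0 <= t < n) 2 / t.+1%:R * path_dissipation x t <=
   V 0%N + \sum_(0 <= t < n) 2 / t.+1%:R * path_noise x t
   + C * \sum_(0 <= t < n) (t.+1%:R ^+ 2)^-1.
  elim: n => [|n IH]; first by rewrite !big_nil mulr0 !addr0.
  rewrite !big_nat_recr//=; have := potential_step x n; rewrite -/(V n) -/(V n.+1) -/C.
  rewrite mulrBr mulrDr; move: IH.
  move: (bigop.body _ _ _) (bigop.body _ _ _) (C * _) (C / _).
  by move: (_ * path_noise x n) (_ * path_dissipation x n) => *; lra.
have V0le : V 0%N <= \sum_(i in F) p i * (1 + `|c|) ^+ 2.
  apply: ler_sum => i iF; rewrite ler_wpM2l ?(ltW (p0 iF))//.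
  rewrite -(real_normK (num_real (_ - c))) ler_sqr ?nnegrE ?addr_ge0//.
  rewrite (le_trans (ler_normB _ _))// lerD2r ger0_norm ?fraction_ge0//.
  exact: fraction_le1.
have -> : potential_bound = \sum_(i in F) p i * (1 + `|c|) ^+ 2 + C * 2.
  by rewrite mulr_suml -big_split/=; apply: eq_bigr => i _; ring.
have := ler_wpM2l C0 (sum_inv_sqr_le R n); have := V0 n; move: V0le telescope.
move: (C * _) (C * _) (V 0%N) (V n) (\sum_(i in F) _).
move: (bigop.body _ _ _) (bigop.body _ _ _) => *; lra.
Qed.

Lemma fraction_slowly_varying x i : i \in F ->
  slowly_varying (fun t => fraction G x t i - c).
Proof.
move=> iF; exists (1 + `|c|) => t; split.
  rewrite (le_trans (ler_normB _ _))// lerD2r ger0_norm ?fraction_ge0//.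
  exact: fraction_le1.
rewrite opprB addrA subrK (le_trans (fraction_step_le x t iF))//.
by rewrite ler_pM2r ?invr_gt0// lerDl.
Qed.

Lemma path_dissipation_slowly_varying x : slowly_varying (path_dissipation x).
Proof.
apply: slowly_varying_sum => i iF.
apply: slowly_varyingM; first exact: slowly_varying_cst.
apply: slowly_varyingM; first exact: fraction_slowly_varying.
apply: slowly_varyingD; first exact: fraction_slowly_varying.
apply: slowly_varyingN; apply: slowly_varying_sum => j jF.
apply: slowly_varyingM; first exact: slowly_varying_cst.
exact: fraction_slowly_varying.
Qed.

End Potential.

(** * Bounded random variables *)

Section BoundedMeasurable.
Variables (R : realType) (d : measure_display) (Omega : measurableType d).
Variable P : probability Omega R.
Implicit Types f g : Omega -> R.

Definition bounded_measurable f : Prop :=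
  measurable_fun setT f /\ exists C : R, forall w, `|f w| <= C.

Lemma bounded_measurable_cst (c : R) : bounded_measurable (fun=> c).
Proof. by split; [exact: measurable_cst|exists `|c|]. Qed.

Lemma bounded_measurableD f g : bounded_measurable f -> bounded_measurable g ->
  bounded_measurable (fun w => f w + g w).
Proof.
move=> [mf [C Cf]] [mg [D Dg]]; split; first exact: measurable_funD.
by exists (C + D) => w; rewrite (le_trans (ler_normD _ _))// lerD.
Qed.

Lemma bounded_measurableM f g : bounded_measurable f -> bounded_measurable g ->
  bounded_measurable (fun w => f w * g w).
Proof.
move=> [mf [C Cf]] [mg [D Dg]]; split; first exact: measurable_funM.
by exists (C * D) => w; rewrite normrM ler_pM.
Qed.

Lemma bounded_measurableN f : bounded_measurable f ->
  bounded_measurable (fun w => - f w).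
Proof.
move=> bf; rewrite (_ : (fun w => _) = fun w => -1 * f w).
  exact: bounded_measurableM (bounded_measurable_cst _) bf.
by apply/funext => w; rewrite mulN1r.
Qed.

Lemma bounded_measurable_integrable f : bounded_measurable f ->
  P.-integrable setT (EFin \o f).
Proof.
move=> [mf [C Cf]]; apply: measurable_bounded_integrable => //.
  by rewrite (le_lt_trans (probability_le1 _ _))// ltry.
exists C; split; first exact: num_real.
by move=> x Cx w _ /=; exact: le_trans (Cf w) (ltW Cx).
Qed.

Definition zero_mean f : Prop :=
  bounded_measurable f /\ (\int[P]_w (f w)%:E = 0)%E.

Lemma zero_mean0 : zero_mean (fun=> 0).
Proof. by split; [exact: bounded_measurable_cst|rewrite integral0]. Qed.

Lemma zero_meanD f g : zero_mean f -> zero_mean g ->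
  zero_mean (fun w => f w + g w).
Proof.
move=> [bf f0] [bg g0]; split; first exact: bounded_measurableD.
under eq_integral do rewrite EFinD.
by rewrite integralD_EFin ?bounded_measurable_integrable//= f0 g0 adde0.
Qed.

Lemma zero_meanZ (a : R) f : zero_mean f -> zero_mean (fun w => a * f w).
Proof.
move=> [bf f0]; split.
  exact: bounded_measurableM (bounded_measurable_cst _) bf.
under eq_integral do rewrite EFinM.
by rewrite integralZl ?f0 ?mule0//; exact: bounded_measurable_integrable.
Qed.

Lemma zero_mean_sum (I : Type) (s : seq I) (Q : pred I) (h : I -> Omega -> R) :
  (forall i, Q i -> zero_mean (h i)) ->
  zero_mean (fun w => \sum_(i <- s | Q i) h i w).
Proof. exact: (sum_closed zero_mean0 zero_meanD). Qed.

Lemma bounded_measurable_sum (I : Type) (s : seq I) (Q : pred I)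
    (h : I -> Omega -> R) :
  (forall i, Q i -> bounded_measurable (h i)) ->
  bounded_measurable (fun w => \sum_(i <- s | Q i) h i w).
Proof.
exact: (sum_closed (bounded_measurable_cst _) bounded_measurableD).
Qed.

Lemma summable_ae (f : nat -> Omega -> R) (M : R) :
  (forall k, bounded_measurable (f k)) -> (forall k w, 0 <= f k w) ->
  (forall n, (\int[P]_w (\sum_(0 <= k < n) f k w)%:E <= M%:E)%E) ->
  {ae P, forall w, cvgn (series (fun k => f k w))}.
Proof.
move=> bf f0 fM; pose S w := (\sum_(0 <= k <oo) (f k w)%:E)%E.
have mf k : measurable_fun setT (fun w => (f k w)%:E).
  by apply/measurable_EFinP; case: (bf k).
have mS : measurable_fun setT S.
  by apply: ge0_emeasurable_sum => // k w _; rewrite lee_fin.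
have S0 w : (0 <= S w)%E by apply: nneseries_ge0 => k _ _; rewrite lee_fin.
have intS : (\int[P]_w S w <= M%:E)%E.
  rewrite integral_nneseries//; last by move=> k w _; rewrite lee_fin.
  apply: lime_le.
    by apply: is_cvg_nneseries => k _ _; apply: integral_ge0 => w _; rewrite lee_fin.
  apply: nearW => n; apply: le_trans (fM n).
  rewrite le_eqVlt; apply/orP; left; apply/eqP.
  under [RHS]eq_integral do rewrite -sumEFin.
  rewrite ge0_integral_sum// => k w _; by rewrite lee_fin.
have Sint : P.-integrable setT S.
  apply/integrableP; split => //.
  under eq_integral do rewrite gee0_abs//.
  by rewrite (le_lt_trans intS)// ltry.
have := integrable_ae measurableT Sint; apply: filterS => w /(_ I) Sw.
apply: nondecreasing_is_cvgn.
  by apply/nondecreasing_seqP => n; rewrite seriesSr lerDl.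
exists (fine (S w)) => _ [n _ <-]; rewrite -lee_fin fineK//.
rewrite /series/= -sumEFin; apply: nneseries_lim_ge => k _ _.
by rewrite lee_fin.
Qed.

End BoundedMeasurable.

(** * The random urn process *)

Section Process.
Variables (R : realType) (N : nat) (G : urn_network R N).
Variables (d : measure_display) (Omega : measurableType d).
Variables (P : probability Omega R) (chi : nat -> 'I_N -> {RV P >-> bool}).

Let path w : nat -> 'I_N -> bool := fun s j => chi s j w.

Lemma chi_bounded_measurable t j :
  bounded_measurable (fun w => (chi t j w)%:R : R).
Proof.
split; last by exists 1 => w; case: (chi t j w); rewrite ?normr0 ?normr1.
by apply: (@measurableT_comp _ _ _ _ _ _ (fun b : bool => b%:R : R)).
Qed.

Lemma white_bounded_measurable t i :
  bounded_measurable (fun w => (white G (path w) t i)%:R : R).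
Proof.
elim: t => [|t IH]; first exact: bounded_measurable_cst.
rewrite (_ : (fun w => _) = fun w => (white G (path w) t i)%:R +
  \sum_(j in in_nbr G i) (r_ G j * (chi t.+1 j w)%:R +
    ((m_ G j)%:R - (beta_ G j)%:R))); last first.
  by apply/funext => w; rewrite white_increment.
apply: bounded_measurableD => //; apply: bounded_measurable_sum => j _.
apply: bounded_measurableD; last exact: bounded_measurable_cst.
apply: bounded_measurableM; first exact: bounded_measurable_cst.
exact: chi_bounded_measurable.
Qed.

Lemma Z_white t i w : Z G chi t i w =
  (white G (path w) t i)%:R / (W0 G i + B0 G i + t * mbar G i)%:R.
Proof. by rewrite /Z /fraction white_black_total. Qed.

Lemma Z_bounded_measurable t i : bounded_measurable (Z G chi t i).
Proof.
rewrite (_ : Z G chi t i = fun w => (white G (path w) t i)%:R *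
    ((W0 G i + B0 G i + t * mbar G i)%:R)^-1).
  apply: bounded_measurableM; first exact: white_bounded_measurable.
  exact: bounded_measurable_cst.
by apply/funext => w; rewrite Z_white.
Qed.

Lemma draw_bounded_measurable t j :
  bounded_measurable (fun w => draw_prob G chi t j w).
Proof.
apply: bounded_measurableD; apply: bounded_measurableM;
  do ?exact: bounded_measurable_cst; do ?exact: Z_bounded_measurable.
apply: bounded_measurableD; first exact: bounded_measurable_cst.
by apply: bounded_measurableN; exact: Z_bounded_measurable.
Qed.

Lemma history_measurable t A : history G chi t A -> measurable A.
Proof.
apply: smallest_sub; first exact: sigma_algebra_measurable.
move=> _ [s [i [B [_ mB ->]]]]; rewrite -[X in measurable X]setTI.
by have [mZ _] := Z_bounded_measurable s i; exact: mZ.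
Qed.

Hypothesis Hprocess : urn_process G chi.

Lemma history_zero_mean t j A : history G chi t A ->
  zero_mean P (fun w => \1_A w * ((chi t.+1 j w)%:R - draw_prob G chi t j w)).
Proof.
move=> hA; have mA := history_measurable hA.
have [_ /(_ _ hA)] := Hprocess t [set j]%SET.
set E := [set w | _] => PE.
have EE w : E w <-> chi t.+1 j w = true.
  by split=> [|h i]; [apply; rewrite inE|rewrite inE => /eqP ->].
have mE : measurable E.
  rewrite (_ : E = setT `&` chi t.+1 j @^-1` [set true]).
    exact: measurable_funP.
  by rewrite setTI; apply/seteqP; split=> w /EE.
have b1 (B : set Omega) : measurable B -> bounded_measurable (\1_B : Omega -> R).
  move=> mB; split; first exact: measurable_indic.
  by exists 1 => w; rewrite indicE; case: (_ \in _); rewrite ?normr0 ?normr1.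
have bp : bounded_measurable (fun w => \1_A w * draw_prob G chi t j w).
  by apply: bounded_measurableM; [exact: b1|exact: draw_bounded_measurable].
have bAE : bounded_measurable (\1_(A `&` E) : Omega -> R).
  by apply: b1; exact: measurableI.
have -> : (fun w => \1_A w * ((chi t.+1 j w)%:R - draw_prob G chi t j w)) =
    fun w => \1_(A `&` E) w - \1_A w * draw_prob G chi t j w.
  apply/funext => w; rewrite mulrBr; congr (_ - _); rewrite !indicE in_setI.
  case: (w \in A); rewrite ?mul0r ?mul1r//=.
  have [cw|cw] := boolP (chi t.+1 j w); first by rewrite mem_set//; exact/EE.
  by rewrite memNset// => /EE; apply/negP.
split; first by apply: bounded_measurableD => //; exact: bounded_measurableN.
under eq_integral do rewrite EFinB.
rewrite integralB_EFin ?bounded_measurable_integrable//.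
rewrite integral_indic ?setIT//; last exact: measurableI.
rewrite [X in (X - _)%E]PE (integral_mkcond A).
suff -> : (\int[P]_w
      ((fun w => (\prod_(i in [set j]%SET) draw_prob G chi t i w)%:E) \_ A) w =
    \int[P]_w (\1_A w * draw_prob G chi t j w)%:E)%E.
  rewrite subee//; apply: integrable_fin_num => //.
  exact: bounded_measurable_integrable.
apply: eq_integral => w _; rewrite patchE indicE big_set1.
by case: ifPn => _; rewrite ?mul1r ?mul0r.
Qed.

(* [Z t i] takes finitely many values, so it is a combination of indicators of
   events of the history. *)
Lemma centered_draw_zero_mean t i j c :
  zero_mean P (fun w => (Z G chi t i w - c) *
    ((chi t.+1 j w)%:R - draw_prob G chi t j w)).
Proof.
set T := (W0 G i + B0 G i + t * mbar G i)%N.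
pose A k : set Omega := [set w | white G (path w) t i = k].
have T0 : T%:R != 0 :> R.
  by rewrite pnatr_eq0 -lt0n ltn_addr// T0_gt0.
have hA k : history G chi t (A k).
  apply: sub_sigma_algebra; exists t, i, [set k%:R / T%:R]; split=> //.
  apply/seteqP; split=> w /=; rewrite Z_white.
    by move=> ->.
  by move=> /(mulIf (invr_neq0 T0)) /eqP; rewrite eqr_nat => /eqP.
rewrite (_ : (fun w => _) = fun w => \sum_(0 <= k < T.+1) (k%:R / T%:R - c) *
   (\1_(A k) w * ((chi t.+1 j w)%:R - draw_prob G chi t j w))).
  by apply: zero_mean_sum => k _; apply: zero_meanZ; exact: history_zero_mean.
apply/funext => w; set k := white G (path w) t i.
have kT : (k < T.+1)%N.
  by rewrite ltnS /T -(white_black_total G (path w)) leq_addr.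
rewrite big_mkord (bigD1 (Ordinal kT))//= big1 ?addr0.
  by rewrite indicE mem_set//= mul1r Z_white.
move=> l /negP lk; rewrite indicE memNset ?mul0r ?mulr0// => wl; apply: lk.
by apply/eqP/val_inj => /=.
Qed.

Lemma path_noise_zero_mean p c t : zero_mean P (fun w => path_noise G p c (path w) t).
Proof.
apply: zero_mean_sum => i _; apply: zero_meanZ.
rewrite (_ : (fun w => _) = fun w => (mbar G i)%:R^-1 *
  \sum_(j in in_nbr G i) r_ G j * ((Z G chi t i w - c) *
    ((chi t.+1 j w)%:R - draw_prob G chi t j w))).
  apply: zero_meanZ; apply: zero_mean_sum => j _; apply: zero_meanZ.
  exact: centered_draw_zero_mean.
apply/funext => w; rewrite /noise mulrCA; congr (_ * _).
by rewrite mulr_sumr; apply: eq_bigr => j _; rewrite mulrCA.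
Qed.

Lemma path_dissipation_bounded_measurable p c t :
  bounded_measurable (fun w => path_dissipation G p c (path w) t).
Proof.
have bZ i : bounded_measurable (fun w => fraction G (path w) t i - c).
  apply: bounded_measurableD; first exact: Z_bounded_measurable.
  exact: bounded_measurable_cst.
apply: bounded_measurable_sum => i _.
apply: bounded_measurableM; first exact: bounded_measurable_cst.
apply: bounded_measurableM; first exact: bZ.
apply: bounded_measurableD; first exact: bZ.
apply: bounded_measurableN; apply: bounded_measurable_sum => j _.
apply: bounded_measurableM; first exact: bounded_measurable_cst.
exact: bZ.
Qed.

End Process.

Unset Implicit Arguments.
Set Strict Implicit.
Theorem corollary3p3 (R : realType) (N : nat) (G : urn_network R N)
  (d : measure_display) (Omega : measurableType d) (P : probability Omega R)
  (chi : nat -> 'I_N -> {RV P >-> bool})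
  (Hprocess : urn_process G chi)
  (Hweak : weakly_connected G)
  (Htypes : forall i, polya_type G i \/ non_polya_type G i)
  (Hstrong : strongly_connected_on G (flexible G))
  (Hcond :
     (exists i, 0 < q_ G i < 1) \/
     (exists2 i, i \in flexible G & non_polya_type G i) \/
     stubborn G <> finset.set0 \/
     [/\ forall i, q_ G i = 0 \/ q_ G i = 1,
         forall i, i \in flexible G -> polya_type G i
       & ~ admits_graph_partition G (flexible G)])
  (muF mu0 : R)
  (SC1 : forall i, i \in flexible G ->
     (mbar G i)%:R^-1 *
       (\sum_(j in (flexible G :&: in_nbr G i)%SET)
          (2 * q_ G j - 1) * r_ G j) = muF)
  (SC2 : forall i, i \in flexible G ->
     (mbar G i)%:R^-1 *
       (\sum_(j in (stubborn G :&: in_nbr G i)%SET)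
          Z0 G j * (2 * q_ G j - 1) * r_ G j
        + \sum_(j in in_nbr G i)
            ((alpha_ G j)%:R - q_ G j * r_ G j)) = mu0) :
  forall i, i \in flexible G ->
    {ae P, forall w, Z G chi t i w @[t --> \oo] --> mu0 / (1 - muF)}.

Proof.
move=> i0 i0F.
have F0 : flexible G != finset.set0 by apply/finset.set0Pn; exists i0.
have [p [p0 pK]] := subinvariant_weights (coupling_ge0 G)
  (@coupling_row_le1 _ _ G) (coupling_conn Hstrong).
have vanish x := dissipation_vanish (coupling_ge0 G)
  (@coupling_row_le1 _ _ G) (bias_le1 G) p0 pK (coupling_conn Hstrong)
  (x := x) (coupling_nondegenerate Hweak Hstrong Hcond F0).
have muF1 : 1 - muF != 0.
  apply/eqP => /eqP; rewrite subr_eq0 eq_sym => /eqP muF1.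
  have /vanish/(_ i0 i0F) : (fun t : nat => dissipation (flexible G) (coupling G)
      (bias G) p (fun=> 1)) @ \oo --> 0.
    rewrite [X in (fun=> X)](_ : _ = 0); first exact: cvg_cst.
    rewrite /dissipation big1// => i iF.
    rewrite coupling_bias_sum//.
    under [X in _ * (_ * (_ - _ * X))]eq_bigr do rewrite mulr1.
    by rewrite SC1// muF1 subrr !mulr0.
  move=> /cvg_lim; rewrite lim_cst// => /(_ (@Rhausdorff R)) /eqP.
  by rewrite oner_eq0.
set c := mu0 / (1 - muF).
have cE : c = muF * c + mu0 by rewrite /c; field.
pose D w t := path_dissipation G p c (fun s j => chi s j w) t.
have D0 w t : 0 <= D w t by exact: path_dissipation_ge0.
have bD k : bounded_measurable (fun w => 2 / k.+1%:R * D w k).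
  apply: bounded_measurableM; first exact: bounded_measurable_cst.
  exact: path_dissipation_bounded_measurable.
have zn n : zero_mean P (fun w => \sum_(0 <= t < n) 2 / t.+1%:R *
    path_noise G p c (fun s j => chi s j w) t).
  apply: zero_mean_sum => t _; apply: zero_meanZ; exact: path_noise_zero_mean.
have : {ae P, forall w, cvgn (series (fun t => 2 / t.+1%:R * D w t))}.
  apply: (summable_ae (M := potential_bound G p c)) => //.
    by move=> k w; rewrite mulr_ge0// divr_ge0.
  move=> n; have [bn en] := zn n.
  have bB := bounded_measurable_cst Omega (potential_bound G p c).
  apply: (@le_trans _ _ (\int[P]_w (potential_bound G p c +
      \sum_(0 <= t < n) 2 / t.+1%:R *
        path_noise G p c (fun s j => chi s j w) t)%:E)%E).
    apply: ge0_le_integral => //.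
    - by move=> w _; rewrite lee_fin sumr_ge0// => t _; rewrite mulr_ge0// divr_ge0.
    - apply/measurable_EFinP.
      by case: (bounded_measurable_sum (index_iota 0 n) (Q := predT) (fun k _ => bD k)).
    - by apply/measurable_EFinP; case: (bounded_measurableD bB bn).
    - by move=> w _; rewrite lee_fin; exact: (potential_sum p0 cE SC1 SC2).
  under eq_integral do rewrite EFinD.
  rewrite integralD_EFin ?bounded_measurable_integrable//= en adde0.
  by rewrite integral_cst// [X in (_ * X)%E]probability_setT mule1.
apply: filterS => w cvgS.
have Dslow : slowly_varying (D w) by exact: path_dissipation_slowly_varying.
have Dcvg : D w @ \oo --> 0.
  apply: slowly_varying_cvg0 => //.
  rewrite (_ : series _ = fun n => 2^-1 * series (fun t => 2 / t.+1%:R * D w t) n).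
    exact: is_cvgMl_tmp.
  apply/funext => n; rewrite /series/= mulr_sumr; apply: eq_bigr => t _.
  by rewrite 2!mulrA mulVf ?pnatr_eq0// mul1r mulrC.
have := vanish _ Dcvg i0 i0F => zc.
rewrite -[X in _ --> X](add0r c).
rewrite (_ : (fun t => Z G chi t i0 w) = fun t =>
  (fraction G (fun s j => chi s j w) t i0 - c) + c).
  by apply: cvgD => //; exact: cvg_cst.
by apply/funext => t; rewrite subrK.
Qed.
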